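(* Let $k$ be a field and $s,n\ge 1$ integers. There is a positive integer $N=N(n,s)$ such that there exist faithful finite-dimensional representations (morphisms of algebraic group schemes over $k$) realising (i) $((\mathfrak{G}^s)_n,\boxtimes)$ as a closed subgroup of the Borel group $\mathbb{B}_N$ of invertible upper-triangular $N\times N$ matrices; (ii) $((\mathfrak{G}^s_+)_n,\boxtimes)$ as a closed subgroup of the unipotent group $\mathbb{U}_N$ of upper-triangular $N\times N$ matrices with all diagonal entries $1$; and there is a faithful representation realising (iii) $((\mathfrak{G}^s)_1,\boxtimes)$ as the group of multiplicative type $\mathbb{T}_s$ of invertible diagonal $s\times s$ matrices.
   Context: Words: $[s]=\{1,\dots,s\}$; a word $w=(i_1\dots i_n)$ has length $|w|=n$. For a commutative unital $k$-algebra $R$, $R_+\langle\langle z_1,\dots,z_s\rangle\rangle$ is the set of formal power series in $s$ non-commuting variables with zero constant term, $f=\sum_{|w|\ge1}X_w(f)z_w$, $z_w=z_{i_1}\cdots z_{i_n}$. $\operatorname{NC}(n)$ is the set of non-crossing partitions of $\{1,\dots,n\}$. The Kreweras complement $K(\pi)$ of $\pi\in\operatorname{NC}(n)$ is the maximal (for the order in which $\sigma\le\pi$ iff every block of $\sigma$ lies in a block of $\pi$) non-crossing partition of $\{\bar1,\dots,\bar n\}$ (identified with $\{1,\dots,n\}$) such that $\pi\cup K(\pi)$ is a non-crossing partition of $1<\bar1<2<\bar2<\dots<n<\bar n$. For $w=(i_1\dots i_n)$ and $V=\{v_1<\dots<v_m\}$, $w|V=(i_{v_1}\dots i_{v_m})$,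 and $X_{w,\pi}(f)=\prod_{V\in\pi}X_{w|V}(f)$. The boxed convolution is given by $X_w(f\boxtimes g)=\sum_{\pi\in\operatorname{NC}(|w|)}X_{w,\pi}(f)\,X_{w,K(\pi)}(g)$; the coefficient at $w$ only depends on coefficients at words of length $\le|w|$. $(\mathfrak{G}^s)_n(R)=\{\sum_{1\le|w|\le n}\alpha_wz_w:\alpha_w\in R,\ \alpha_i\in R^\times\text{ for }i=1,\dots,s\}$ and $(\mathfrak{G}^s_+)_n(R)$ is the subset with $\alpha_i=1$ for $i=1,\dots,s$; these are groups under $\boxtimes$ truncated to words of length $\le n$, and the functors $R\mapsto(\mathfrak{G}^s)_n(R)$, $R\mapsto(\mathfrak{G}^s_+)_n(R)$ (acting coefficientwise on morphisms) are affine algebraic group schemes over $k$. *)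

(* Defs.v *)
From HB Require Import structures.
From mathcomp Require Import all_boot all_order all_algebra.

Set Implicit Arguments.
Unset Strict Implicit.
Unset Printing Implicit Defensive.

Import GRing.Theory.
Local Open Scope ring_scope.

(* The ground set is ordered through the injection pos : T -> nat. *)
Definition noncrossing (T : finType) (pos : T -> nat) (P : {set {set T}}) :=
  [forall B in P, forall C in P, (B != C) ==>
    ~~ [exists a in B, exists b in C, exists c in B, exists d in C,
          [&& pos a < pos b, pos b < pos c & pos c < pos d]%N]].

Definition NC (n : nat) : {set {set {set 'I_n}}} :=
  [set P : {set {set 'I_n}} | partition P [set: 'I_n] &
                              noncrossing (@nat_of_ord n) P].

Definition refines (T : finType) (P Q : {set {set T}}) :=
  [forall B in P, exists C in Q, B \subset C].

(* inl i stands for i and inr i for i-bar, so that the order induced by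
   interleave_pos is 0 < 0-bar < 1 < 1-bar < ... *)
Definition interleave_pos (n : nat) (x : 'I_n + 'I_n) : nat :=
  match x with inl i => i.*2 | inr i => i.*2.+1 end.

Definition interleave (n : nat) (P Q : {set {set 'I_n}}) :
    {set {set 'I_n + 'I_n}} :=
  [set (@inl 'I_n 'I_n) @: B | B : {set 'I_n} in P] :|:
  [set (@inr 'I_n 'I_n) @: B | B : {set 'I_n} in Q].

Definition compatible (n : nat) (P Q : {set {set 'I_n}}) :=
  (Q \in NC n) && noncrossing (@interleave_pos n) (interleave P Q).

Definition is_kreweras (n : nat) (P Q : {set {set 'I_n}}) :=
  compatible P Q &&
  [forall Q' : {set {set 'I_n}}, compatible P Q' ==> refines Q' Q].

(* The default value set0 is irrelevant: the complement of an element of NC n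
   exists and is unique. *)
Definition kreweras (n : nat) (P : {set {set 'I_n}}) : {set {set 'I_n}} :=
  odflt set0 [pick Q | is_kreweras P Q].

(* A word is a sequence of letters in 'I_s; a series is given by its coefficient
   function seq 'I_s -> R, whose value at the empty word is never used. *)
Definition restr (s : nat) (w : seq 'I_s) (V : {set 'I_(size w)}) : seq 'I_s :=
  [seq tnth (in_tuple w) i | i <- enum V].

Definition coef_part (s : nat) (R : comNzRingType) (X : seq 'I_s -> R)
    (w : seq 'I_s) (P : {set {set 'I_(size w)}}) : R :=
  \prod_(V in P) X (restr V).

Definition boxed_coef (s : nat) (R : comNzRingType) (X Y : seq 'I_s -> R)
    (w : seq 'I_s) : R :=
  \sum_(P in NC (size w)) coef_part X P * coef_part Y (kreweras P).

Definition word (s n : nat) := {w : n.-bseq 'I_s | w != [::] :> seq 'I_s}.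

Definition letters (s n : nat) (w : word s n) : seq 'I_s := val (val w).

Definition tseries (s n : nat) (R : Type) := {ffun word s n -> R}.

Definition coef (s n : nat) (R : comNzRingType) (f : tseries s n R)
    (w : seq 'I_s) : R :=
  oapp f 0 (obind insub (insub w : option (n.-bseq 'I_s))).

Definition boxconv (s n : nat) (R : comNzRingType) (f g : tseries s n R) :
    tseries s n R :=
  [ffun w => boxed_coef (coef f) (coef g) (letters w)].

Definition map_tseries (s n : nat) (R S : Type) (phi : R -> S)
    (f : tseries s n R) : tseries s n S := [ffun w => phi (f w)].

(* Group schemes over k through their functors of points on (nonzero)
   commutative k-algebras.  Only the data entering the notions of morphism and
   of closed immersion are recorded: a homomorphism of groups is a map
   compatible with the multiplications. *)

Record group_functor (k : fieldType) := GroupFunctor {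
  points :> comUnitAlgType k -> Type;
  base_change : forall R S : comUnitAlgType k,
    {lrmorphism R -> S} -> points R -> points S;
  gmul : forall R : comUnitAlgType k, points R -> points R -> points R
}.

Record group_hom (k : fieldType) (G H : group_functor k) := GroupHom {
  hom_map :> forall R : comUnitAlgType k, G R -> H R;
  hom_natural : forall (R S : comUnitAlgType k) (phi : {lrmorphism R -> S})
    (x : G R), hom_map (base_change phi x) = base_change phi (hom_map x);
  hom_mul : forall (R : comUnitAlgType k) (x y : G R),
    hom_map (gmul x y) = gmul (hom_map x) (hom_map y)
}.

(* The library's ideals are proper, whereas the unit ideal is needed here. *)
Definition is_ideal (R : comNzRingType) (I : R -> Prop) : Prop :=
  [/\ I 0, forall a b, I a -> I b -> I (a + b) & forall a b, I b -> I (a * b)].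

(* A monomorphism whose image is a closed subfunctor (Demazure-Gabriel,
   Jantzen): over every point y of H with values in R, the locus where y lies
   in the image is the closed subscheme Spec (R / I) of Spec R. *)
Definition closed_immersion (k : fieldType) (G H : group_functor k)
    (rho : group_hom G H) : Prop :=
  (forall R : comUnitAlgType k, injective (rho R)) /\
  (forall (R : comUnitAlgType k) (y : H R), exists I : R -> Prop,
     is_ideal I /\
     forall (S : comUnitAlgType k) (phi : {lrmorphism R -> S}),
       (exists x : G S, rho S x = base_change phi y) <->
       (forall a : R, I a -> phi a = 0)).

Definition is_isomorphism (k : fieldType) (G H : group_functor k)
    (rho : group_hom G H) : Prop :=
  forall R : comUnitAlgType k, bijective (rho R).

Definition borel_pred (R : comUnitRingType) (N : nat) (A : 'M[R]_N) : bool :=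
  is_trig_mx A^T && (A \in unitmx).

Definition unip_pred (R : comUnitRingType) (N : nat) (A : 'M[R]_N) : bool :=
  is_trig_mx A^T && [forall i, A i i == 1].

Definition torus_pred (R : comUnitRingType) (N : nat) (A : 'M[R]_N) : bool :=
  is_diag_mx A && (A \in unitmx).

Section MatrixClosure.
Variables (R S : comUnitRingType) (N : nat) (phi : {rmorphism R -> S}).
Implicit Types A B : 'M[R]_N.

Lemma trig_tr_mulE A B : is_trig_mx A^T -> is_trig_mx B^T ->
  is_trig_mx (A *m B)^T /\ forall i, (A *m B) i i = A i i * B i i.
Proof.
move=> /is_trig_mxP hA /is_trig_mxP hB.
have zA (i j : 'I_N) : (j < i)%N -> A i j = 0 by move=> h; move: (hA j i h); rewrite mxE.
have zB (i j : 'I_N) : (j < i)%N -> B i j = 0 by move=> h; move: (hB j i h); rewrite mxE.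
split=> [|i].
  apply/is_trig_mxP => i j ij; rewrite !mxE big1 // => l _.
  case: (ltnP l j) => lj; first by rewrite zA ?mul0r.
  by rewrite zB ?mulr0 // (leq_trans ij).
rewrite mxE (bigD1 i) //= big1 ?addr0 // => l /eqP li.
case: (ltngtP l i) => il; first by rewrite zA ?mul0r.
- by rewrite zB ?mulr0.
- by case: li; apply: val_inj.
Qed.

Lemma map_unitmxW A : A \in unitmx -> map_mx phi A \in unitmx.
Proof. by rewrite !unitmxE det_map_mx; apply: rmorph_unit. Qed.

Lemma borel_mul A B : borel_pred A -> borel_pred B -> borel_pred (A *m B).
Proof.
move=> /andP[tA uA] /andP[tB uB]; apply/andP; split; last by rewrite unitmx_mul uA.
by have [] := trig_tr_mulE tA tB.
Qed.

Lemma trig_tr_map A : is_trig_mx A^T -> is_trig_mx (map_mx phi A)^T.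
Proof.
move=> /is_trig_mxP h; apply/is_trig_mxP => i j ij.
by have := h i j ij; rewrite !mxE => ->; rewrite rmorph0.
Qed.

Lemma borel_map A : borel_pred A -> borel_pred (map_mx phi A).
Proof. by move=> /andP[/trig_tr_map tA /map_unitmxW uA]; apply/andP. Qed.

Lemma unip_mul A B : unip_pred A -> unip_pred B -> unip_pred (A *m B).
Proof.
move=> /andP[tA /forallP dA] /andP[tB /forallP dB].
have [tAB dAB] := trig_tr_mulE tA tB; rewrite /unip_pred tAB.
by apply/forallP => i; rewrite dAB (eqP (dA i)) (eqP (dB i)) mul1r.
Qed.

Lemma unip_map A : unip_pred A -> unip_pred (map_mx phi A).
Proof.
move=> /andP[/trig_tr_map tA /forallP dA]; rewrite /unip_pred tA.
by apply/forallP => i; rewrite mxE (eqP (dA i)) rmorph1.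
Qed.

Lemma torus_mul A B : torus_pred A -> torus_pred B -> torus_pred (A *m B).
Proof.
move=> /andP[/is_diag_mxP dA uA] /andP[/is_diag_mxP dB uB].
rewrite /torus_pred unitmx_mul uA uB !andbT; apply/is_diag_mxP => i j ij.
rewrite mxE big1 // => l _.
by case: (eqVneq (i : nat) l) => il; [rewrite dB ?mulr0 // -il | rewrite dA ?mul0r].
Qed.

Lemma torus_map A : torus_pred A -> torus_pred (map_mx phi A).
Proof.
move=> /andP[/is_diag_mxP dA /map_unitmxW uA]; apply/andP; split=> //.
by apply/is_diag_mxP => i j ij; rewrite mxE dA // rmorph0.
Qed.

End MatrixClosure.

Section MatrixGroups.
Variables (k : fieldType) (N : nat).

Definition borel : group_functor k :=
  @GroupFunctor k (fun R => {A : 'M[R]_N | borel_pred A})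
    (fun R S phi A => exist _ (map_mx phi (sval A)) (borel_map phi (svalP A)))
    (fun R A B => exist _ (sval A *m sval B) (borel_mul (svalP A) (svalP B))).

Definition unipotent : group_functor k :=
  @GroupFunctor k (fun R => {A : 'M[R]_N | unip_pred A})
    (fun R S phi A => exist _ (map_mx phi (sval A)) (unip_map phi (svalP A)))
    (fun R A B => exist _ (sval A *m sval B) (unip_mul (svalP A) (svalP B))).

Definition torus : group_functor k :=
  @GroupFunctor k (fun R => {A : 'M[R]_N | torus_pred A})
    (fun R S phi A => exist _ (map_mx phi (sval A)) (torus_map phi (svalP A)))
    (fun R A B => exist _ (sval A *m sval B) (torus_mul (svalP A) (svalP B))).

End MatrixGroups.

Definition gser_pred (s n : nat) (R : comUnitRingType) (f : tseries s n R) :=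
  [forall i : 'I_s, coef f [:: i] \is a GRing.unit].

Definition gser1_pred (s n : nat) (R : comUnitRingType) (f : tseries s n R) :=
  [forall i : 'I_s, coef f [:: i] == 1].

Lemma partition_I1 (P : {set {set 'I_1}}) :
  partition P [set: 'I_1] = (P == [set [set: 'I_1]]).
Proof.
apply/idP/eqP => [hP|->]; last first.
  rewrite /partition /cover big_set1 eqxx trivIset1 inE eq_sym.
  by apply/set0Pn; exists ord0; rewrite inE.
have sT (B : {set 'I_1}) : B != set0 -> B = setT.
  move=> /set0Pn[x xB]; apply/setP => y.
  by rewrite !inE (ord1 y) -(ord1 x) xB.
case/and3P: hP => /eqP cP _ n0.
have TP : setT \in P.
  have : ord0 \in cover P by rewrite cP inE.
  case/bigcupP=> B BP xB; rewrite -(sT B) //; apply/set0Pn; exists ord0; exact: xB.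
apply/setP => B; rewrite !inE; apply/idP/eqP => [BP|-> //].
by apply: sT; apply: contraNneq n0 => <-.
Qed.

Lemma noncrossing_setT1 : noncrossing (@nat_of_ord 1) [set [set: 'I_1]].
Proof.
apply/forallP => B; apply/implyP; rewrite inE => /eqP->.
by apply/forallP => C; apply/implyP; rewrite inE => /eqP->; rewrite eqxx.
Qed.

Lemma NC_1 : NC 1 = [set [set [set: 'I_1]]].
Proof.
apply/setP => P; rewrite !inE partition_I1.
by case: eqP => // ->; rewrite noncrossing_setT1.
Qed.

Lemma kreweras_1 : kreweras [set [set: 'I_1]] = [set [set: 'I_1]].
Proof.
rewrite /kreweras; case: pickP => [Q /andP[/andP[+ _] _]|/=].
  by rewrite NC_1 inE => /eqP.
move=> /(_ [set setT]) /negP[]; apply/andP; split; last first.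
  apply/forallP => Q; apply/implyP => /andP[+ _]; rewrite NC_1 inE => /eqP->.
  apply/forallP => B; apply/implyP => BP; apply/existsP; exists B.
  by rewrite BP subxx.
rewrite /compatible NC_1 set11 /=.
have pos1 (x : 'I_1 + 'I_1) : (interleave_pos x < 2)%N.
  by case: x => i; rewrite (ord1 i).
apply/forallP => B; apply/implyP => _; apply/forallP => C; apply/implyP => _.
apply/implyP => _; apply/negP.
case/exists_inP=> a _ /exists_inP[b _ /exists_inP[c _ /exists_inP[d _]]].
case/and3P=> ab bc _.
by have := leq_ltn_trans (leq_ltn_trans (leq0n _) ab) bc; rewrite ltnNge -ltnS pos1.
Qed.

Lemma boxed_coef_letter (s : nat) (R : comNzRingType) (X Y : seq 'I_s -> R)
  (i : 'I_s) : boxed_coef X Y [:: i] = X [:: i] * Y [:: i].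
Proof.
rewrite /boxed_coef NC_1 big_set1 kreweras_1 /coef_part !big_set1.
suff -> : @restr s [:: i] setT = [:: i] by [].
by rewrite /restr enum_setT -enumT enum_ordSl enum_ord0.
Qed.

Lemma coef_letters (s n : nat) (R : comNzRingType) (f : tseries s n R) (w : word s n) :
  coef f (letters w) = f w.
Proof.
by rewrite /coef /letters valK /= valK.
Qed.

(* For n = 0 the coefficient at a letter is 0, by the definition of coef. *)
Lemma coef_boxconv_letter (s n : nat) (R : comNzRingType) (f g : tseries s n R)
  (i : 'I_s) : coef (boxconv f g) [:: i] = coef f [:: i] * coef g [:: i].
Proof.
case: n f g => [|n] f g.
  by rewrite /coef insubN //= mul0r.
have hw : (size [:: i] <= n.+1)%N by [].
have -> : [:: i] = letters (exist _ (Bseq hw) isT : word s n.+1) by [].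
by rewrite coef_letters ffunE [letters _]/= boxed_coef_letter.
Qed.

Lemma coef_map_tseries (s n : nat) (R S : comNzRingType)
  (phi : {rmorphism R -> S}) (f : tseries s n R) (w : seq 'I_s) :
  coef (map_tseries phi f) w = phi (coef f w).
Proof.
rewrite /coef; case: (obind _ _) => [u|] /=; first by rewrite ffunE.
by rewrite rmorph0.
Qed.

Section SeriesClosure.
Variables (s n : nat) (R S : comUnitRingType) (phi : {rmorphism R -> S}).
Implicit Types f g : tseries s n R.

Lemma gser_mul f g : gser_pred f -> gser_pred g -> gser_pred (boxconv f g).
Proof.
move=> /forallP hf /forallP hg; apply/forallP => i.
by rewrite coef_boxconv_letter unitrM hf hg.
Qed.

Lemma gser_map f : gser_pred f -> gser_pred (map_tseries phi f).
Proof.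
move=> /forallP hf; apply/forallP => i.
by rewrite coef_map_tseries; apply: rmorph_unit.
Qed.

Lemma gser1_mul f g : gser1_pred f -> gser1_pred g -> gser1_pred (boxconv f g).
Proof.
move=> /forallP hf /forallP hg; apply/forallP => i.
by rewrite coef_boxconv_letter (eqP (hf i)) (eqP (hg i)) mul1r.
Qed.

Lemma gser1_map f : gser1_pred f -> gser1_pred (map_tseries phi f).
Proof.
move=> /forallP hf; apply/forallP => i.
by rewrite coef_map_tseries (eqP (hf i)) rmorph1.
Qed.

End SeriesClosure.

Section SeriesGroups.
Variables (k : fieldType) (s n : nat).

Definition gser : group_functor k :=
  @GroupFunctor k (fun R => {f : tseries s n R | gser_pred f})
    (fun R S phi f =>
       exist _ (map_tseries phi (sval f)) (gser_map phi (svalP f)))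
    (fun R f g =>
       exist _ (boxconv (sval f) (sval g)) (gser_mul (svalP f) (svalP g))).

Definition gser1 : group_functor k :=
  @GroupFunctor k (fun R => {f : tseries s n R | gser1_pred f})
    (fun R S phi f =>
       exist _ (map_tseries phi (sval f)) (gser1_map phi (svalP f)))
    (fun R f g =>
       exist _ (boxconv (sval f) (sval g)) (gser1_mul (svalP f) (svalP g))).

End SeriesGroups.

(* Main.v *)
(* The boxed convolution is the product of an incidence algebra.  For a word
   W of length n and noncrossing partitions sg <= pi of a set V of positions of
   W, put in position (sg, pi) the coefficient of f along the relative Kreweras
   complement of sg in pi, which is the common refinement of pi and of the
   Kreweras complement of sg.  The relative complement maps the interval
   [sg, pi] bijectively onto the partitions finer than the complement of sg in
   pi, and complements are compatible with this bijection; this makes the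
   resulting matrices multiplicative in f.  They are triangular for a linear
   extension of refinement, the diagonal entries are products of coefficients at
   letters, and every coefficient of f is itself an entry.  Reading off these
   entries gives a natural retraction, so the representation is a closed
   immersion. *)
Require Import Defs.
From mathcomp Require Import all_boot all_order all_algebra.
From mathcomp Require Import zify.

Set Implicit Arguments.
Unset Strict Implicit.
Unset Printing Implicit Defensive.

Import GRing.Theory.
Local Open Scope ring_scope.

(** * Partitions, noncrossing partitions and complements *)

(** A boxed coefficient is a sum of products over blocks, so it is not linear in the coefficients of
    either factor. Functions on intervals of partitions linearise it, because those products become
    matrix entries. Multiplying out a product over several blocks involves subwords on arbitrary
    subsets of positions, and for this reason partitions of every set [V] occur, and not only those
    of the full set.

    The maximality that defines the Kreweras complement is awkward to compute with. It is replaced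
    by a pointwise criterion: for [x < y], the bars of [x] and [y] lie in one block exactly when the
    half-open interval from [x] (excluded) to [y] (included) is a union of blocks of [P]. Relative
    complements are then intersections of equivalence relations. The crux is that, for [sg] finer
    than [tau], a set of positions is a union of [tau]-blocks as soon as it is one for [sg] and for
    the relative complement of [sg] in [tau]. Injectivity, the image of an interval and the
    compatibility of complements all rest on this. *)

Section SameBlock.
Variable T : finType.
Implicit Types (P Q : {set {set T}}) (V B : {set T}) (x y z : T).

(** Partitions are compared through this relation: refinement becomes an implication between
    relations, and equality of partitions of one set becomes pointwise equivalence. *)
Definition same_block P x y := [exists B in P, (x \in B) && (y \in B)].

Lemma same_blockP P x y :
  reflect (exists B, [/\ B \in P, x \in B & y \in B]) (same_block P x y).
Proof.
apply: (iffP exists_inP) => [[B BP /andP[xB yB]]|[B [BP xB yB]]]; exists B => //.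
by rewrite xB.
Qed.

Lemma same_block_sym P x y : same_block P x y = same_block P y x.
Proof. by apply: eq_existsb => B; rewrite [(x \in B) && _]andbC. Qed.

Lemma same_blockE P x y : trivIset P -> same_block P x y = (y \in pblock P x).
Proof.
move=> tP; apply/same_blockP/idP => [[B [BP xB yB]]|yx].
  by rewrite (def_pblock tP BP xB).
have xP : x \in cover P.
  by move: yx; rewrite /pblock; case: pickP => [B /andP[BP xB] _|];
     [apply/bigcupP; exists B | rewrite inE].
by exists (pblock P x); rewrite pblock_mem ?mem_pblock.
Qed.

Lemma same_block_mem P V B x y :
  partition P V -> B \in P -> x \in B -> same_block P x y = (y \in B).
Proof. by case/and3P=> _ tP _ BP xB; rewrite same_blockE // (def_pblock tP BP xB). Qed.

Lemma same_block_trans P V : partition P V -> transitive (same_block P).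
Proof.
case/and3P=> _ tP _ y x z; rewrite !same_blockE // => yx zy.
by rewrite -(same_pblock tP yx).
Qed.

Lemma same_block_refl P V x : partition P V -> same_block P x x = (x \in V).
Proof. by case/and3P=> /eqP <- tP _; rewrite same_blockE // mem_pblock. Qed.

Lemma same_block_inl P V x y : partition P V -> same_block P x y -> x \in V.
Proof.
move=> pP xy; rewrite -(same_block_refl x pP); apply: (same_block_trans pP xy).
by rewrite same_block_sym.
Qed.

Lemma same_block_inr P V x y : partition P V -> same_block P x y -> y \in V.
Proof. by rewrite same_block_sym; apply: same_block_inl. Qed.

Lemma same_block_congr P V x y z :
  partition P V -> same_block P x y -> same_block P x z = same_block P y z.
Proof.
move=> pP xy; apply/idP/idP; last exact: (same_block_trans pP) xy.
by apply: (same_block_trans pP); rewrite same_block_sym.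
Qed.

Lemma refinesP P Q V : partition P V -> partition Q V ->
  reflect (forall x y, same_block P x y -> same_block Q x y) (refines P Q).
Proof.
move=> pP pQ; apply: (iffP forall_inP) => [PQ x y|PQ B BP].
  case/same_blockP=> B [/PQ /exists_inP[C CQ /subsetP BC] /BC xC /BC yC].
  by apply/same_blockP; exists C.
have /set0Pn[x xB] : B != set0.
  by apply: contraTneq BP => ->; case/and3P: pP.
have xV : x \in V by rewrite -(same_block_refl x pP) (same_block_mem x pP BP xB).
have /bigcupP[C CQ xC] : x \in cover Q by rewrite (cover_partition pQ).
apply/exists_inP; exists C => //; apply/subsetP => y yB.
rewrite -(same_block_mem y pQ CQ xC); apply: PQ.
by rewrite (same_block_mem y pP BP xB).
Qed.

Lemma eq_partition P Q V : partition P V -> partition Q V ->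
  (forall x y, same_block P x y = same_block Q x y) -> P = Q.
Proof.
move=> pP pQ eqPQ; rewrite -(equivalence_partition_pblock pP).
rewrite -(equivalence_partition_pblock pQ); apply: eq_in_imset => x xV.
case/and3P: pP => _ tP _; case/and3P: pQ => _ tQ _.
by apply/setP => y; rewrite !inE -!same_blockE // eqPQ.
Qed.

Lemma refines_anti P Q V : partition P V -> partition Q V ->
  refines P Q -> refines Q P -> P = Q.
Proof.
move=> pP pQ /(refinesP pP pQ) PQ /(refinesP pQ pP) QP.
by apply: (eq_partition pP pQ) => x y; apply/idP/idP; [apply: PQ | apply: QP].
Qed.

Lemma refines_refl P : refines P P.
Proof. by apply/forall_inP => B BP; apply/exists_inP; exists B. Qed.

Lemma same_block_equivalence_partition (R : rel T) V x y :
  {in V & &, equivalence_rel R} ->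
  same_block (equivalence_partition R V) x y = [&& x \in V, y \in V & R x y].
Proof.
move=> eqR; have pR := equivalence_partitionP eqR.
have [xV|xV] := boolP (x \in V); last first.
  by apply: contraNF xV => /(same_block_inl pR).
have [yV|yV] := boolP (y \in V); last first.
  by apply: contraNF yV => /(same_block_inr pR).
rewrite same_blockE; last by case/and3P: pR.
by rewrite (pblock_equivalence_partition eqR).
Qed.

Lemma noncrossingP (pos : T -> nat) P V : partition P V ->
  reflect (forall a b c d, (pos a < pos b)%N -> (pos b < pos c)%N ->
             (pos c < pos d)%N -> same_block P a c -> same_block P b d ->
             same_block P a b)
          (noncrossing pos P).
Proof.
move=> pP; apply: (iffP forall_inP) => [ncP a b c d ab bc cd|ncP B BP].
  case/same_blockP=> B [BP aB cB] /same_blockP[C [CP bC dC]].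
  rewrite (same_block_mem b pP BP aB).
  have /forall_inP/(_ C CP) := ncP B BP; case: eqVneq => [-> //|_] /=.
  case/negP; apply/exists_inP; exists a => //; apply/exists_inP; exists b => //.
  apply/exists_inP; exists c => //; apply/exists_inP; exists d => //.
  by rewrite ab bc.
apply/forall_inP => C CP; apply/implyP => BC; apply: contra BC.
case/exists_inP=> a aB /exists_inP[b bC /exists_inP[c cB /exists_inP[d dC]]].
case/and3P=> ab bc cd; case/and3P: (pP) => _ tP _.
have := ncP a b c d ab bc cd; rewrite (same_block_mem c pP BP aB) cB.
rewrite (same_block_mem d pP CP bC) dC => /(_ isT isT).
rewrite (same_block_mem b pP BP aB) => bB.
by rewrite -(def_pblock tP BP bB) (def_pblock tP CP bC).
Qed.

End SameBlock.

(** * Complements as saturation conditions on intervals *)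

Section Complement.
Variable n : nat.
Implicit Types (P Q sg tau pi chi : {set {set 'I_n}}) (V B : {set 'I_n}).
Implicit Types (x y z a b c d i j k : 'I_n) (D : 'I_n -> bool).

Definition ncpart V : {set {set {set 'I_n}}} :=
  [set P | partition P V & noncrossing (@nat_of_ord n) P].

Lemma ncpart_partition V P : P \in ncpart V -> partition P V.
Proof. by rewrite inE => /andP[]. Qed.

Lemma ncpart_cross V P a b c d : P \in ncpart V -> (a < b)%N -> (b < c)%N ->
  (c < d)%N -> same_block P a c -> same_block P b d -> same_block P a b.
Proof. by rewrite inE => /andP[pP /(noncrossingP _ pP)]; apply. Qed.

Definition saturated P D := forall a b, same_block P a b -> D a = D b.

(* The half-open interval between x and y, whichever is the smaller. *)
Definition between x y a := (x < a)%N (+) (y < a)%N.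

(** For [x < y] the unbarred points lying between the bars of [x] and [y] are those [a] with
    [x < a <= y]. The condition says that no block of [P] crosses the chord joining the two bars. *)
Definition krel P x y :=
  [forall a, forall b, same_block P a b ==> (between x y a == between x y b)].

Lemma krelP P x y : reflect (saturated P (between x y)) (krel P x y).
Proof.
apply: (iffP forallP) => h a.
  by move=> b ab; move/forallP/(_ b): (h a); rewrite ab => /eqP.
by apply/forallP => b; apply/implyP => /h ->.
Qed.

Lemma betweenE x y a : (x <= y)%N -> between x y a = (x < a <= y)%N.
Proof. by rewrite /between; lia. Qed.

Lemma krelPle P x y : (x <= y)%N ->
  reflect (saturated P (fun a => x < a <= y)%N) (krel P x y).
Proof. by move=> xy; apply: (iffP (krelP _ _ _)) => h a b /h; rewrite !betweenE. Qed.

Lemma krel_refl P x : krel P x x.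
Proof. by apply/krelP => a b _; rewrite /between !addbb. Qed.

Lemma krel_sym P x y : krel P x y = krel P y x.
Proof.
by apply/krelP/krelP => h a b /h; rewrite /between addbC => ->; rewrite addbC.
Qed.

(** The exclusive or of the indicators for [x, y] and for [y, z] is the one for [x, z], and
    saturated sets are closed under symmetric difference; no case analysis on the order of the three
    points arises. *)
Lemma krel_trans P : transitive (krel P).
Proof.
move=> y x z /krelP xy /krelP yz; apply/krelP => a b ab.
by have := xy a b ab; have := yz a b ab; rewrite /between; lia.
Qed.

Lemma krel_congr P x y z : krel P x y -> krel P x z = krel P y z.
Proof.
move=> xy; apply/idP/idP; last exact: krel_trans xy.
by apply: krel_trans; rewrite krel_sym.
Qed.

(** The interval from [a] to [b] is the one from [a] to [c] minus the one from [b] to [d], and a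
    difference of saturated sets is saturated. *)
Lemma krel_cross P a b c d : (a < b)%N -> (b < c)%N -> (c < d)%N ->
  krel P a c -> krel P b d -> krel P a b.
Proof.
move=> ab bc cd; have ac := ltn_trans ab bc; have bd := ltn_trans bc cd.
move=> /(krelPle _ (ltnW ac)) h1 /(krelPle _ (ltnW bd)) h2.
by apply/(krelPle _ (ltnW ab)) => u v uv; have := h1 u v uv; have := h2 u v uv; lia.
Qed.

Definition kcompl P := equivalence_partition (krel P) (cover P).

Lemma krel_equivalence P V : {in V & &, equivalence_rel (krel P)}.
Proof. by move=> x y z _ _ _; split=> [|xy]; [apply: krel_refl | apply: krel_congr]. Qed.

Lemma kcompl_partition P V : partition P V -> partition (kcompl P) V.
Proof.
by move=> pP; rewrite /kcompl (cover_partition pP);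
   apply/equivalence_partitionP/krel_equivalence.
Qed.

Lemma same_block_kcompl P V x y : partition P V ->
  same_block (kcompl P) x y = [&& x \in V, y \in V & krel P x y].
Proof.
move=> pP; rewrite /kcompl (cover_partition pP).
exact/same_block_equivalence_partition/krel_equivalence.
Qed.

Lemma kcompl_nc P V : partition P V -> kcompl P \in ncpart V.
Proof.
move=> pP; have pK := kcompl_partition pP; rewrite inE pK.
apply/(noncrossingP _ pK) => a b c d ab bc cd.
rewrite !(same_block_kcompl _ _ pP) => /and3P[-> _ ac] /and3P[-> _ bd].
exact: krel_cross ab bc cd ac bd.
Qed.

(* The common refinement of the complement of sg and of pi; for sg finer than pi
   this is the relative Kreweras complement of sg in pi. *)
Definition relcompl sg pi :=
  equivalence_partition (fun x y => krel sg x y && same_block pi x y) (cover pi).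

Lemma relcompl_equivalence sg pi V : partition pi V ->
  {in V & &, equivalence_rel (fun x y => krel sg x y && same_block pi x y)}.
Proof.
move=> pp x y z _ _ zV; split; first by rewrite /= krel_refl (same_block_refl _ pp).
by case/andP=> /krel_congr -> /(same_block_congr _ pp) ->.
Qed.

Lemma relcompl_partition sg pi V : partition pi V -> partition (relcompl sg pi) V.
Proof.
move=> pp; rewrite /relcompl (cover_partition pp).
exact/equivalence_partitionP/relcompl_equivalence.
Qed.

Lemma same_block_relcompl sg pi V x y : partition pi V ->
  same_block (relcompl sg pi) x y = krel sg x y && same_block pi x y.
Proof.
move=> pp; rewrite /relcompl (cover_partition pp).
rewrite same_block_equivalence_partition; last exact: relcompl_equivalence.
apply/and3P/idP => [[]//|/[dup] /andP[_ xy] ->].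
by rewrite (same_block_inl pp xy) (same_block_inr pp xy).
Qed.

Lemma relcompl_nc sg pi V : pi \in ncpart V -> relcompl sg pi \in ncpart V.
Proof.
move=> ncp; have pp := ncpart_partition ncp; have pr := relcompl_partition sg pp.
rewrite inE pr; apply/(noncrossingP _ pr) => a b c d ab bc cd.
rewrite !(same_block_relcompl _ _ _ pp) => /andP[ac1 ac2] /andP[bd1 bd2].
by rewrite (krel_cross ab bc cd ac1 bd1) (ncpart_cross ncp ab bc cd ac2 bd2).
Qed.

Lemma relcompl_refines_kcompl sg pi V : partition sg V -> partition pi V ->
  refines (relcompl sg pi) (kcompl sg).
Proof.
move=> ps pp; apply/(refinesP (relcompl_partition sg pp) (kcompl_partition ps)).
move=> x y; rewrite (same_block_relcompl _ _ _ pp) (same_block_kcompl _ _ ps).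
by case/andP=> -> xy; rewrite (same_block_inl pp xy) (same_block_inr pp xy).
Qed.

Lemma saturated_imply P D :
  (forall a b, same_block P a b -> D a -> D b) -> saturated P D.
Proof.
by move=> h a b ab; apply/idP/idP; apply: h; rewrite // same_block_sym.
Qed.

(* Both cases move from j to an end of its sg-block, chosen so that the interval
   to i consists of whole sg-blocks. *)
Lemma relcompl_gap sg tau V i j : sg \in ncpart V -> tau \in ncpart V ->
  refines sg tau -> (i < j)%N -> same_block tau i j ->
  (forall c, (i < c < j)%N -> ~~ same_block tau i c) ->
  exists2 k, krel sg i k & same_block sg k j.
Proof.
move=> ncs nct st ij tij gap.
have ps := ncpart_partition ncs; have pt := ncpart_partition nct.
have sub := refinesP ps pt st.
(* If [j] is not the least element of its [sg]-block, [k] is its predecessor there. Then [k <= i]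
   because [i] and [j] are neighbours in their [tau]-block. *)
have [k0 hk0|nok] := pickP (fun k => (k < j)%N && same_block sg k j).
  case: (@arg_maxnP _ k0 (fun k => (k < j)%N && same_block sg k j) val hk0) => k.
  case/andP=> kj skj kmax; exists k => //.
  have notj x : (k < x < j)%N -> ~~ same_block sg x j.
    by case/andP=> kx xj; apply: contraL kx => sxj; rewrite -leqNgt; apply: kmax; rewrite xj.
  have ki : (k <= i)%N.
    rewrite leqNgt; apply/negP => ik; have /gap/negP[] : (i < k < j)%N by rewrite ik.
    by rewrite (same_block_congr _ pt tij) same_block_sym; apply: sub.
  rewrite krel_sym; apply/(krelPle _ ki)/saturated_imply => /= x y sxy /andP[kx xi].
  have xj := leq_ltn_trans xi ij.
  have nxj : ~~ same_block sg x j by apply: notj; rewrite kx.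
  have txy := sub _ _ sxy.
  have nyj : ~~ same_block sg y j by rewrite -(same_block_congr _ ps sxy).
  have nyk : ~~ same_block sg y k.
    by apply: contra nyj => yk; rewrite (same_block_congr _ ps yk).
  have nty : (i < y < j)%N -> False.
    move=> iyj; have /negP[] := gap _ iyj.
    have [xi' | ix] := ltnP x i.
      have ncx : same_block tau x i.
        by apply: (ncpart_cross nct xi' _ _ txy tij); case/andP: iyj.
      by rewrite -(same_block_congr _ pt ncx).
    by have -> : i = x by apply/val_inj/eqP; rewrite eqn_leq ix.
  have [yk|yk|/val_inj yk] := ltngtP y k.
  - by case/negP: nyk; apply: (ncpart_cross ncs yk kx xj _ skj); rewrite same_block_sym.
  - rewrite /= leqNgt; apply/negP => iy.
    have [yj|yj|/val_inj yj] := ltngtP y j.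
    + by apply: nty; rewrite iy.
    + case/negP: nyk; rewrite -(same_block_congr _ ps sxy) same_block_sym.
      exact: (ncpart_cross ncs kx xj yj skj sxy).
    + by rewrite yj (same_block_refl _ ps) (same_block_inr ps skj) in nyj.
  - by rewrite yk (same_block_refl _ ps) (same_block_inl ps skj) in nyk.
(* Now [j] is the least element of its [sg]-block; [k] is the greatest, so the whole block lies
   between [i] and [k]. *)
have sjj : same_block sg j j by rewrite (same_block_refl _ ps) (same_block_inr pt tij).
case: (@arg_maxnP _ j (fun k => same_block sg k j) val sjj) => k skj maxk.
have kmax x : same_block sg x j -> (x <= k)%N by apply: maxk.
exists k => //; have jk : (j <= k)%N by apply: kmax.
apply/(krelPle _ (leq_trans (ltnW ij) jk))/saturated_imply => /= x y sxy /andP[ix xk].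
have txy := sub _ _ sxy.
have [xj|nxj] := boolP (same_block sg x j).
  have yj : same_block sg y j by rewrite -(same_block_congr _ ps sxy).
  rewrite (kmax _ yj) andbT; apply: leq_trans ij _; rewrite leqNgt.
  by apply: contraFN (nok y) => ->.
have ntx : ~~ same_block tau i x || (j <= x)%N.
  by case: (ltnP x j) => xj; rewrite ?orbT // gap // ix.
have [xj|jx] := ltnP x j.
  have {}ntx : ~~ same_block tau i x by rewrite gap // ix.
  have [yi|yi|/val_inj yi] := ltngtP y i.
  - case/negP: ntx; rewrite same_block_sym in txy.
    have yi' := ncpart_cross nct yi ix xj txy tij.
    by rewrite -(same_block_congr _ pt yi').
  - rewrite /= leqNgt; apply/negP => ky; case/negP: ntx.
    exact: (ncpart_cross nct ix xj (leq_ltn_trans jk ky) tij txy).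
  - by rewrite yi same_block_sym in txy; rewrite txy in ntx.
have {}jx : (j < x)%N.
  by rewrite ltn_neqAle jx andbT; apply: contraNneq nxj => /val_inj <-.
have {}xk : (x < k)%N.
  by rewrite ltn_neqAle xk andbT; apply: contraNneq nxj => /val_inj ->.
rewrite same_block_sym in skj; rewrite same_block_sym in nxj.
apply/andP; split.
  apply: leq_trans ij _; rewrite leqNgt; apply/negP => yj; case/negP: nxj.
  rewrite same_block_sym in sxy.
  have jy := ncpart_cross ncs yj jx xk sxy skj.
  by rewrite -(same_block_congr _ ps jy).
rewrite leqNgt; apply/negP => ky; case/negP: nxj.
exact: (ncpart_cross ncs jx xk ky skj sxy).
Qed.

(* In the lattice of all partitions, tau is the join of sg and of the relative
   complement of sg in tau. *)
Lemma saturated_join sg tau V D : sg \in ncpart V -> tau \in ncpart V ->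
  refines sg tau -> saturated sg D -> saturated (relcompl sg tau) D ->
  saturated tau D.
Proof.
move=> ncs nct st Ds Dr; have ps := ncpart_partition ncs.
have pt := ncpart_partition nct; have sub := refinesP ps pt st.
suff lt m i j : (i < j)%N -> (j - i <= m)%N -> same_block tau i j -> D i = D j.
  move=> a b ab; have [h|h|/val_inj -> //] := ltngtP a b; first exact: lt ab.
  by apply/esym/(lt _ _ _ h (leqnn _)); rewrite same_block_sym.
(* Induction on the distance: a [tau]-mate strictly between [i] and [j] splits the pair, and
   neighbours are linked through [k] by one step in the relative complement and one in [sg]. *)
elim: m i j => [|m IH] i j ij ijm tij.
  by rewrite leqn0 subn_eq0 leqNgt ij in ijm.
have [/existsP[c /andP[/andP[ic cj] tic]]|/existsPn nogap] :=
    boolP [exists c : 'I_n, (i < c < j)%N && same_block tau i c].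
  have cim : (c - i <= m)%N by rewrite -ltnS (leq_trans _ ijm) // ltn_sub2r.
  have jcm : (j - c <= m)%N by rewrite -ltnS (leq_trans _ ijm) // ltn_sub2l.
  rewrite (IH i c) //; apply: IH => //.
  by rewrite -(same_block_congr _ pt tic).
have [c icj|k ik kj] := relcompl_gap ncs nct st ij tij.
  by apply: contra (nogap c) => ->; rewrite icj.
rewrite -(Ds _ _ kj); apply: Dr; rewrite (same_block_relcompl _ _ _ pt) ik /=.
by rewrite (same_block_congr _ pt tij) same_block_sym; apply: sub.
Qed.

(** A noncrossing partition is recovered from its saturated intervals. If [P] joins [i < j] and [Q]
    does not, some [Q]-saturated interval with both ends in [V] contains exactly one of [i] and [j],
    so it cannot be [P]-saturated. *)
Lemma krel_refines P Q V : P \in ncpart V -> Q \in ncpart V ->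
  (forall x y, x \in V -> y \in V -> krel Q x y -> krel P x y) -> refines P Q.
Proof.
move=> ncP ncQ QP; have pP := ncpart_partition ncP; have pQ := ncpart_partition ncQ.
suff lt i j : (i < j)%N -> same_block P i j -> same_block Q i j.
  apply/(refinesP pP pQ) => i j ij; have [h|h|/val_inj eij] := ltngtP i j.
  - exact: lt.
  - by rewrite same_block_sym; apply: lt => //; rewrite same_block_sym.
  - by rewrite eij (same_block_refl _ pQ) (same_block_inr pP ij).
move=> ij Pij; apply: contraT => nQij.
have iV := same_block_inl pP Pij; have jV := same_block_inr pP Pij.
have Qii : same_block Q i i by rewrite (same_block_refl _ pQ).
have absurd x y : x \in V -> y \in V -> (x <= y)%N -> krel Q x y ->
    (x < i <= y)%N = (x < j <= y)%N.
  by move=> xV yV xy /(QP _ _ xV yV)/(krelPle _ xy); apply.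
have sep x y : same_block Q x y -> ~~ same_block Q i x -> ~~ same_block Q i y.
  by rewrite ![same_block Q i _]same_block_sym => /(same_block_congr _ pQ) ->.
have Qtr x y : same_block Q i x -> same_block Q i y -> same_block Q x y.
  by move=> /(same_block_congr y pQ) ->.
have Qii' : same_block Q i i && (i < j)%N by rewrite Qii.
case: (@arg_maxnP _ i (fun k => same_block Q i k && (k < j)%N) val Qii') => k.
case/andP=> Qik kj maxk.
have kmax x : same_block Q i x -> (x < j)%N -> (x <= k)%N.
  by move=> Qix xj; apply: maxk; rewrite Qix.
have ik := kmax _ Qii ij.
have kV := same_block_inr pQ Qik.
(* Case where [j] falls into a gap of the [Q]-block of [i], between consecutive elements [k] and
   [k']: the gap is saturated. Its right end [y] is the last point of [V] before [k']. *)
have [k0 hk0|nok] := pickP (fun k' => same_block Q i k' && (j < k')%N).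
  case: (@arg_minnP _ k0 (fun k' => same_block Q i k' && (j < k')%N) val hk0) => k'.
  case/andP=> Qik' jk' mink.
  have kmin x : same_block Q i x -> (j < x)%N -> (k' <= x)%N.
    by move=> Qix jx; apply: mink; rewrite Qix.
  have jV' : (j \in V) && (j < k')%N by rewrite jV.
  case: (@arg_maxnP _ j (fun y => (y \in V) && (y < k')%N) val jV') => y.
  case/andP=> yV yk' maxy.
  have ymax x : x \in V -> (x < k')%N -> (x <= y)%N.
    by move=> xV xk; apply: maxy; rewrite xV.
  have jy := ymax _ jV jk'.
  have ky := leq_trans (ltnW kj) jy.
  have nQ x : (k < x < k')%N -> ~~ same_block Q i x.
    case/andP=> kx xk'; apply/negP => Qix.
    have [xj|xj|/val_inj xj] := ltngtP x j.
    + by have := kmax x Qix xj; rewrite leqNgt kx.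
    + by have := kmin x Qix xj; rewrite leqNgt xk'.
    + by rewrite -xj Qix in nQij.
  suff /(absurd _ _ kV yV ky) : krel Q k y by rewrite ltnNge ik kj jy.
  apply/(krelPle _ ky)/saturated_imply => /= x z Qxz /andP[kx xy].
  have xk' : (x < k')%N := leq_ltn_trans xy yk'.
  have nQix : ~~ same_block Q i x by apply: nQ; rewrite kx.
  have nQiz := sep _ _ Qxz nQix; have zV := same_block_inr pQ Qxz.
  have [zk|kz|/val_inj zk] := ltngtP z k; last by rewrite zk Qik in nQiz.
    case/negP: nQiz; rewrite same_block_sym in Qxz.
    have := ncpart_cross ncQ zk kx xk' Qxz (Qtr _ _ Qik Qik').
    by rewrite same_block_sym -(same_block_congr _ pQ Qik).
  have [zk'|zk'|/val_inj zk'] := ltngtP z k'; last by rewrite zk' Qik' in nQiz.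
    exact: ymax.
  case/negP: nQix; rewrite (same_block_congr _ pQ Qik).
  exact: (ncpart_cross ncQ kx xk' zk' (Qtr _ _ Qik Qik') Qxz).
(* Otherwise the block of [i] ends at [k], before [j], and its convex hull from [k0] to [k]
   separates [i] from [j]. *)
have kmax' x : same_block Q i x -> (x <= k)%N.
  move=> Qix; apply: kmax => //; rewrite ltnNge leq_eqVlt negb_or.
  apply/andP; split; last by apply: contraFN (nok x) => ->; rewrite Qix.
  by apply: contraNneq nQij => /val_inj ->.
case: (@arg_minnP _ i (same_block Q i) val Qii) => k0 Qik0 mink0.
have k0min x : same_block Q i x -> (k0 <= x)%N by apply: mink0.
have Qk := Qtr _ _ Qik0 Qik.
have k0i : (k0 <= i)%N by apply: k0min.
have nQin x y : same_block Q x y -> ~~ same_block Q i x -> (k0 < x < k)%N ->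
    (k0 < y < k)%N.
  move=> Qxy nQix /andP[k0x xk]; have nQiy := sep _ _ Qxy nQix.
  have [yk0|k0y|/val_inj yk0] := ltngtP y k0; last by rewrite yk0 Qik0 in nQiy.
    case/negP: nQiy; rewrite same_block_sym in Qxy.
    have := ncpart_cross ncQ yk0 k0x xk Qxy Qk.
    by rewrite same_block_sym -(same_block_congr _ pQ Qik0).
  have [//|ky|/val_inj yk] := ltngtP y k; last by rewrite yk Qik in nQiy.
  case/negP: nQix; rewrite (same_block_congr _ pQ Qik0).
  exact: (ncpart_cross ncQ k0x xk ky Qk Qxy).
have inC x y : same_block Q x y -> (k0 <= x <= k)%N -> (k0 <= y <= k)%N.
  move=> Qxy xin; have [Qix|nQix] := boolP (same_block Q i x).
    have Qiy : same_block Q i y by rewrite (same_block_congr _ pQ Qix).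
    by rewrite k0min // kmax'.
  suff /andP[/ltnW-> /ltnW-> //] : (k0 < y < k)%N.
  apply: (nQin _ _ Qxy nQix).
  rewrite !ltn_neqAle; case/andP: xin => -> ->; rewrite !andbT.
  by apply/andP; split; apply: contraNneq nQix => /val_inj; [move=> <- | move=> ->].
(* The left end of a half-open interval is excluded, so the hull needs the predecessor [u] of [k0]
   in [V] as its left end. When [k0] is the first point of [V], the rest of [V] after [k] serves
   instead. *)
have [u0 hu0|nou] := pickP (fun u => (u \in V) && (u < k0)%N).
  case: (@arg_maxnP _ u0 (fun u => (u \in V) && (u < k0)%N) val hu0) => u.
  case/andP=> uV uk0 maxu.
  have umax x : x \in V -> (x < k0)%N -> (x <= u)%N.
    by move=> xV xk0; apply: maxu; rewrite xV.
  have uk : (u <= k)%N := ltnW (leq_trans uk0 (leq_trans k0i ik)).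
  suff /(absurd _ _ uV kV uk) : krel Q u k.
    by rewrite ik (leq_trans uk0 k0i) [(j <= k)%N]leqNgt kj andbF.
  apply/(krelPle _ uk)/saturated_imply => /= x z Qxz /andP[ux xk].
  suff /andP[k0z ->] : (k0 <= z <= k)%N by rewrite andbT (leq_trans uk0).
  apply: (inC _ _ Qxz); rewrite xk andbT leqNgt; apply/negP => xk0.
  by have := umax x (same_block_inl pQ Qxz) xk0; rewrite leqNgt ux.
case: (@arg_maxnP _ j [in V] val jV) => y yV maxy.
have ymax x : x \in V -> (x <= y)%N by apply: maxy.
have jy := ymax _ jV.
have ky := leq_trans (ltnW kj) jy.
suff /(absurd _ _ kV yV ky) : krel Q k y by rewrite ltnNge ik kj jy.
apply/(krelPle _ ky)/saturated_imply => /= x z Qxz /andP[kx _].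
rewrite (ymax _ (same_block_inr pQ Qxz)) andbT ltnNge; apply/negP => zk.
have k0z : (k0 <= z)%N.
  by rewrite leqNgt; apply: contraFN (nou z) => ->; rewrite (same_block_inr pQ Qxz).
rewrite same_block_sym in Qxz.
by have := inC _ _ Qxz; rewrite k0z zk => /(_ isT)/andP[_]; rewrite leqNgt kx.
Qed.

(** A set saturated for a coarser partition is saturated for a finer one, which gives the reversal
    of the order; the converse is [krel_refines]. *)
Lemma kcompl_refines V sg tau : sg \in ncpart V -> tau \in ncpart V ->
  refines (kcompl tau) (kcompl sg) = refines sg tau.
Proof.
move=> ncs nct; have ps := ncpart_partition ncs; have pt := ncpart_partition nct.
have pKs := kcompl_partition ps; have pKt := kcompl_partition pt.
apply/idP/idP => [/(refinesP pKt pKs) h|/(refinesP ps pt) h].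
  apply: krel_refines ncs nct _ => x y xV yV xy.
  have := h x y; rewrite (same_block_kcompl _ _ ps) (same_block_kcompl _ _ pt).
  by rewrite xV yV; apply.
apply/(refinesP pKt pKs) => x y.
rewrite (same_block_kcompl _ _ ps) (same_block_kcompl _ _ pt).
case/and3P=> -> -> /krelP xy; apply/krelP => a b ab; exact/xy/h.
Qed.

Lemma kcompl_inj V : {in ncpart V &, injective (@kcompl)}.
Proof.
move=> sg tau ncs nct eqK.
apply: (refines_anti (ncpart_partition ncs) (ncpart_partition nct)).
  by rewrite -(kcompl_refines ncs nct) eqK refines_refl.
by rewrite -(kcompl_refines nct ncs) eqK refines_refl.
Qed.

(** An injective self-map of a finite set is onto, so no inverse complement has to be
    constructed. *)
Lemma kcompl_ncpart V : kcompl @: ncpart V = ncpart V.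
Proof.
apply/eqP; rewrite eqEcard card_in_imset ?leqnn ?andbT; last exact: kcompl_inj.
by apply/subsetP => _ /imsetP[P ncP ->]; apply/kcompl_nc/ncpart_partition.
Qed.

Lemma relcompl_refines sg pi V : partition pi V -> refines (relcompl sg pi) pi.
Proof.
move=> pp; apply/(refinesP (relcompl_partition sg pp) pp) => x y.
by rewrite (same_block_relcompl _ _ _ pp) => /andP[].
Qed.

Lemma refines_trans V P Q R : partition P V -> partition Q V -> partition R V ->
  refines P Q -> refines Q R -> refines P R.
Proof.
move=> pP pQ pR /(refinesP pP pQ) PQ /(refinesP pQ pR) QR.
by apply/(refinesP pP pR) => x y /PQ/QR.
Qed.

Lemma krel_relcompl V sg tau x y : sg \in ncpart V -> tau \in ncpart V ->
  refines sg tau -> krel (relcompl sg tau) x y && krel sg x y = krel tau x y.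
Proof.
move=> ncs nct st; have ps := ncpart_partition ncs; have pt := ncpart_partition nct.
apply/andP/krelP => [[/krelP h1 /krelP h2]|h].
  exact: (saturated_join ncs nct st h2 h1).
split; apply/krelP => a b ab; apply: h; last exact: (refinesP ps pt st).
by apply: (refinesP (relcompl_partition sg pt) pt (relcompl_refines sg pt)).
Qed.

(** This is [saturated_join] applied to a block of [pi] as the saturated set. *)
Lemma refines_join V sg tau pi : sg \in ncpart V -> tau \in ncpart V ->
  pi \in ncpart V -> refines sg tau -> refines sg pi ->
  refines (relcompl sg tau) pi -> refines tau pi.
Proof.
move=> ncs nct ncp st sp rp; have ps := ncpart_partition ncs.
have pt := ncpart_partition nct; have pp := ncpart_partition ncp.
apply/(refinesP pt pp) => a b ab.
suff /(_ _ _ ab) <- : saturated tau (same_block pi a).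
  by rewrite (same_block_refl _ pp) (same_block_inl pt ab).
apply: (saturated_join ncs nct st) => c d cd.
all: rewrite ![same_block pi a _]same_block_sym; apply: (same_block_congr _ pp).
  exact: (refinesP ps pp sp).
exact: (refinesP (relcompl_partition sg pt) pp rp).
Qed.

Lemma relcompl_inj V sg : sg \in ncpart V ->
  {in [set tau in ncpart V | refines sg tau] &, injective (relcompl sg)}.
Proof.
move=> ncs t1 t2 /setIdP[nc1 s1] /setIdP[nc2 s2] eqr.
have p1 := ncpart_partition nc1; have p2 := ncpart_partition nc2.
apply: (refines_anti p1 p2).
  by apply: (refines_join ncs nc1 nc2 s1 s2); rewrite eqr; apply: relcompl_refines p2.
by apply: (refines_join ncs nc2 nc1 s2 s1); rewrite -eqr; apply: relcompl_refines p1.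
Qed.

(* Injective, and onto by counting: the complementation kcompl exchanges the
   partitions coarser than sg with those finer than kcompl sg. *)
Lemma relcompl_onto V sg : sg \in ncpart V ->
  relcompl sg @: [set tau in ncpart V | refines sg tau] =
  [set chi in ncpart V | refines chi (kcompl sg)].
Proof.
move=> ncs; have ps := ncpart_partition ncs.
apply/eqP; rewrite eqEcard card_in_imset; last exact: relcompl_inj.
apply/andP; split.
  apply/subsetP => _ /imsetP[tau /setIdP[nct st] ->]; apply/setIdP; split.
    exact: relcompl_nc.
  exact: relcompl_refines_kcompl ps (ncpart_partition nct).
apply: leq_trans (leq_imset_card kcompl _); apply/subset_leq_card/subsetP => chi.
case/setIdP; rewrite -{1}kcompl_ncpart => /imsetP[tau nct ->].
rewrite (kcompl_refines ncs nct) => st.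
by apply: imset_f; apply/setIdP.
Qed.

(** A [chi] below [relcompl sg pi] is also below [kcompl sg], hence comes from some [tau] above
    [sg]; the join property then forces [tau] below [pi]. *)
Lemma relcompl_interval V sg pi : sg \in ncpart V -> pi \in ncpart V ->
  refines sg pi ->
  relcompl sg @: [set tau in ncpart V | refines sg tau && refines tau pi] =
  [set chi in ncpart V | refines chi (relcompl sg pi)].
Proof.
move=> ncs ncp sp; have ps := ncpart_partition ncs; have pp := ncpart_partition ncp.
have prp := relcompl_partition sg pp.
apply/setP => chi; apply/imsetP/setIdP => [[tau /setIdP[nct /andP[st tp]] ->]|].
  have pt := ncpart_partition nct; split; first exact: relcompl_nc.
  apply/(refinesP (relcompl_partition sg pt) prp) => x y.
  rewrite (same_block_relcompl _ _ _ pt) (same_block_relcompl _ _ _ pp).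
  by case/andP=> -> /(refinesP pt pp tp).
case=> ncc cr; have pc := ncpart_partition ncc.
have : chi \in relcompl sg @: [set tau in ncpart V | refines sg tau].
  rewrite relcompl_onto //; apply/setIdP; split=> //.
  apply: (refines_trans pc prp (kcompl_partition ps) cr).
  exact: relcompl_refines_kcompl ps pp.
case/imsetP=> tau /setIdP[nct st] def_chi; exists tau => //; apply/setIdP; split=> //.
rewrite st /=; apply: (refines_join ncs nct ncp st sp); rewrite -def_chi.
exact: refines_trans pc prp pp cr (relcompl_refines _ pp).
Qed.

(** Once unfolded, the left side is the intersection of [pi] with two [krel] relations, which
    [krel_relcompl] merges into [krel tau]. *)
Lemma relcompl_relcompl V sg tau pi : sg \in ncpart V -> tau \in ncpart V ->
  pi \in ncpart V -> refines sg tau ->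
  relcompl (relcompl sg tau) (relcompl sg pi) = relcompl tau pi.
Proof.
move=> ncs nct ncp st; have pp := ncpart_partition ncp.
have prp := relcompl_partition sg pp.
apply: (eq_partition (relcompl_partition _ prp) (relcompl_partition _ pp)) => x y.
rewrite !(same_block_relcompl _ _ _ prp) !(same_block_relcompl _ _ _ pp).
by rewrite andbA (krel_relcompl _ _ ncs nct st).
Qed.

(** For distinct points of one block, the interval between them contains the larger and not the
    smaller, so it is not saturated. *)
Lemma relcompl_self V sg : sg \in ncpart V -> relcompl sg sg = [set [set x] | x in V].
Proof.
move=> ncs; have ps := ncpart_partition ncs.
rewrite /relcompl (cover_partition ps); apply: eq_in_imset => x xV.
apply/setP => y; rewrite !inE; apply/and3P/eqP => [[yV /krelP k xy]|->].
  apply: val_inj; have := k _ _ xy; rewrite /between !ltnn /= addbF.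
  by case: ltngtP.
by rewrite xV krel_refl (same_block_refl _ ps).
Qed.

Lemma partition_singletons V : partition [set [set x] | x in V] V.
Proof.
apply/and3P; split.
- apply/eqP/setP => x; apply/bigcupP/idP => [[B /imsetP[y yV ->] /set1P-> //]|xV].
  by exists [set x]; rewrite ?set11 ?imset_f.
- apply/trivIsetP => _ _ /imsetP[x _ ->] /imsetP[y _ ->].
  by rewrite disjoints1 inE; apply: contraNneq => ->.
- by apply/imsetP => -[x _ /setP/(_ x)]; rewrite !inE eqxx.
Qed.

Lemma same_block_singletons V x y :
  same_block [set [set x] | x in V] x y = (x \in V) && (x == y).
Proof.
apply/same_blockP/andP => [[_ [/imsetP[z zV ->] /set1P-> /set1P->]]|[xV /eqP<-]] //.
by exists [set x]; rewrite set11 imset_f.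
Qed.

Lemma ncpart_singletons V : [set [set x] | x in V] \in ncpart V.
Proof.
have p1 := partition_singletons V; rewrite inE p1; apply/(noncrossingP _ p1).
move=> a b c d ab bc _; rewrite same_block_singletons => /andP[_ /eqP ac].
by move: bc; rewrite -ac ltnNge ltnW.
Qed.

Lemma partition_setV V : V != set0 -> partition [set V] V.
Proof. by move=> V0; rewrite /partition /cover big_set1 eqxx trivIset1 inE eq_sym. Qed.

Lemma ncpart_setV V : V != set0 -> [set V] \in ncpart V.
Proof.
move=> V0; have pV := partition_setV V0; rewrite inE pV; apply/(noncrossingP _ pV).
move=> a b c d _ _ _ /(same_block_inl pV) aV /(same_block_inl pV) bV.
by rewrite (same_block_mem _ pV (set11 _) aV).
Qed.

Lemma relcompl_singletons V : V != set0 ->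
  relcompl [set [set x] | x in V] [set V] = [set V].
Proof.
move=> V0; have pV := partition_setV V0.
apply: (eq_partition (relcompl_partition _ pV) pV) => x y.
rewrite (same_block_relcompl _ _ _ pV) andb_idl // => _; apply/krelP => a b.
by rewrite same_block_singletons => /andP[_ /eqP->].
Qed.

Lemma refines_singletons V P : partition P V -> refines [set [set x] | x in V] P.
Proof.
move=> pP; apply/(refinesP (partition_singletons V) pP) => x y.
by rewrite same_block_singletons => /andP[xV /eqP<-]; rewrite (same_block_refl _ pP).
Qed.

(** Since [i] sits at [2i] and its bar at [2i + 1], a bar [x] precedes [a] when [x < a], and [a]
    precedes a bar [y] when [a <= y]. Crossings between a block of [P] and a block of [Q] are thus
    failures of saturation for half-open intervals. *)
Lemma compatibleE P Q : P \in NC n ->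
  compatible P Q = (Q \in NC n) && refines Q (kcompl P).
Proof.
move=> ncP; apply: andb_id2l => ncQ.
have pP : partition P setT by apply: ncpart_partition ncP.
have pQ : partition Q setT by apply: ncpart_partition ncQ.
have pK := kcompl_partition pP.
apply/forall_inP/(refinesP pQ pK) => [nc x y|QK B'].
  rewrite (same_block_kcompl _ _ pP) !inE /=.
  wlog xy : x y / (x < y)%N => [hw|].
    have [h|h|/val_inj ->] := ltngtP x y; first exact: hw; last by rewrite krel_refl.
    by rewrite same_block_sym krel_sym; apply: hw.
  case/same_blockP=> C [CQ xC yC]; apply/(krelPle _ (ltnW xy))/saturated_imply.
  move=> /= a b /same_blockP[B [BP aB bB]] /andP[xa ay].
  have BI : inl @: B \in interleave P Q by rewrite inE imset_f.
  have CI : inr @: C \in interleave P Q by rewrite inE orbC imset_f.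
  have neqBC : inl @: B != inr @: C :> {set 'I_n + 'I_n}.
    by apply/eqP => /setP/(_ (inl a)); rewrite imset_f // => /esym/imsetP[].
  have neqCB : inr @: C != inl @: B :> {set 'I_n + 'I_n} by rewrite eq_sym.
  (* A [b] outside the interval gives a crossing: [b], bar [x], [a], bar [y] if it lies to the left,
     and bar [x], [a], bar [y], [b] if it lies to the right. *)
  apply: contraT; rewrite negb_and -leqNgt -ltnNge => /orP[bx|yb].
    have /forall_inP/(_ _ CI)/implyP/(_ neqBC)/negP[] := nc _ BI.
    apply/exists_inP; exists (inl b); rewrite ?imset_f //.
    apply/exists_inP; exists (inr x); rewrite ?imset_f //.
    apply/exists_inP; exists (inl a); rewrite ?imset_f //.
    apply/exists_inP; exists (inr y); rewrite ?imset_f //=.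
    by rewrite !(ltn_Sdouble, ltnS, leq_double) bx xa.
  have /forall_inP/(_ _ BI)/implyP/(_ neqCB)/negP[] := nc _ CI.
  apply/exists_inP; exists (inr x); rewrite ?imset_f //.
  apply/exists_inP; exists (inl a); rewrite ?imset_f //.
  apply/exists_inP; exists (inr y); rewrite ?imset_f //.
  apply/exists_inP; exists (inl b); rewrite ?imset_f //=.
  by rewrite !(ltn_Sdouble, ltnS, leq_double) xa ay.
have inK C x y : C \in Q -> x \in C -> y \in C -> krel P x y.
  move=> CQ xC yC; have := QK x y; rewrite (same_block_kcompl _ _ pP) !inE /=; apply.
  by apply/same_blockP; exists C.
have inP B a b : B \in P -> a \in B -> b \in B -> same_block P a b.
  by move=> BP aB bB; apply/same_blockP; exists B.
case/setUP=> /imsetP[B BP ->]; apply/forall_inP => C' /setUP[] /imsetP[C CP ->].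
all: apply/implyP => neqBC; apply/negP.
all: case/exists_inP=> _ /imsetP[a aB ->] /exists_inP[_ /imsetP[b bC ->]].
all: case/exists_inP=> _ /imsetP[c cB ->] /exists_inP[_ /imsetP[d dC ->]].
all: case/and3P=> /= ab bc cd.
- rewrite ltn_double in ab; rewrite ltn_double in bc; rewrite ltn_double in cd.
  have ncPT : P \in ncpart setT by [].
  have := ncpart_cross ncPT ab bc cd (inP _ _ _ BP aB cB) (inP _ _ _ CP bC dC).
  rewrite (same_block_mem _ pP BP aB) => bB; case/eqP: neqBC; congr (_ @: _).
  by rewrite -(def_pblock _ BP bB) ?(def_pblock _ CP bC) //; case/and3P: pP.
- rewrite ltnS leq_double in ab; rewrite ltn_Sdouble in bc.
  rewrite ltnS leq_double in cd; have bd := leq_trans (ltnW bc) cd.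
  have /(krelPle _ bd)/(_ _ _ (inP _ _ _ BP aB cB)) := inK _ _ _ CP bC dC.
  by rewrite bc cd ltnNge ab.
- rewrite ltn_Sdouble in ab; rewrite ltnS leq_double in bc.
  rewrite ltn_Sdouble in cd; have ac := leq_trans (ltnW ab) bc.
  have /(krelPle _ ac)/(_ _ _ (inP _ _ _ CP bC dC)) := inK _ _ _ BP aB cB.
  by rewrite ab bc [(d <= c)%N]leqNgt cd andbF.
- rewrite ltnS ltn_double in ab; rewrite ltnS ltn_double in bc; rewrite ltnS ltn_double in cd.
  have ncQT : Q \in ncpart setT by [].
  have bl B0 x y : B0 \in Q -> x \in B0 -> y \in B0 -> same_block Q x y.
    by move=> B0Q xB yB; apply/same_blockP; exists B0.
  have := ncpart_cross ncQT ab bc cd (bl _ _ _ BP aB cB) (bl _ _ _ CP bC dC).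
  rewrite (same_block_mem _ pQ BP aB) => bB; case/eqP: neqBC; congr (_ @: _).
  by rewrite -(def_pblock _ BP bB) ?(def_pblock _ CP bC) //; case/and3P: pQ.
Qed.

Lemma krewerasE P : P \in NC n -> kreweras P = kcompl P.
Proof.
move=> ncP; have pP : partition P setT by apply: ncpart_partition ncP.
have ncK : kcompl P \in NC n by apply: kcompl_nc pP.
have cK : compatible P (kcompl P) by rewrite compatibleE // ncK refines_refl.
rewrite /kreweras; case: pickP => [Q /andP[cQ /forallP maxQ]|/(_ (kcompl P))] /=.
  have pQ : partition Q setT by case/andP: cQ => ncQ _; apply: ncpart_partition ncQ.
  apply: (refines_anti pQ (kcompl_partition pP)).
    by move: cQ; rewrite compatibleE // => /andP[].
  exact: implyP (maxQ _) cK.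
case/negP; rewrite /is_kreweras cK; apply/forallP => Q; apply/implyP.
by rewrite compatibleE // => /andP[].
Qed.

End Complement.

(** * Transport along increasing maps *)

Section Transport.
Variables (r n : nat) (iota : 'I_r -> 'I_n).
Hypothesis iota_mono : {mono iota : i j / (i < j)%N}.
Implicit Types (P : {set {set 'I_r}}) (V B : {set 'I_r}).

Let iota_inj : injective iota.
Proof.
move=> i j eij; apply: val_inj; have := iota_mono i j; have := iota_mono j i.
by rewrite eij ltnn; case: ltngtP.
Qed.

Let img P : {set {set 'I_n}} := [set iota @: B | B : {set 'I_r} in P].

Lemma same_block_img P a b : same_block (img P) (iota a) (iota b) = same_block P a b.
Proof.
apply/same_blockP/same_blockP => [[_ [/imsetP[B BP ->]]]|[B [BP aB bB]]].
  by rewrite !mem_imset // => aB bB; exists B.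
by exists (iota @: B); rewrite !imset_f.
Qed.

Lemma same_block_imgP P x y : same_block (img P) x y ->
  exists a b, [/\ x = iota a, y = iota b & same_block P a b].
Proof.
case/same_blockP=> _ [/imsetP[B BP ->] /imsetP[a aB ->] /imsetP[b bB ->]].
by exists a, b; split=> //; apply/same_blockP; exists B.
Qed.

Lemma partition_img P V : partition P V -> partition (img P) (iota @: V).
Proof.
move=> pP; apply/and3P; split.
- apply/eqP/setP => x; apply/bigcupP/imsetP => [[_ /imsetP[B BP ->]]|[a aV ->]].
    by case/imsetP=> a aB ->; exists a => //; rewrite -(cover_partition pP);
       apply/bigcupP; exists B.
  move: aV; rewrite -(cover_partition pP) => /bigcupP[B BP aB].
  by exists (iota @: B); rewrite ?imset_f.
- apply/trivIsetP => _ _ /imsetP[B BP ->] /imsetP[C CP ->] neqBC.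
  rewrite imset_disjoint //; case/and3P: pP => _ /trivIsetP tP _; apply: tP => //.
  by apply: contraNneq neqBC => ->.
- apply/imsetP => -[B BP /esym/eqP]; rewrite imset_eq0 => /eqP B0.
  by case/and3P: pP => _ _; rewrite -B0 BP.
Qed.

Lemma krel_img P a b : krel (img P) (iota a) (iota b) = krel P a b.
Proof.
apply/krelP/krelP => [h c d cd|h x y /same_block_imgP[c [d [-> -> cd]]]].
  by have := h (iota c) (iota d); rewrite same_block_img /between !iota_mono; apply.
by have := h _ _ cd; rewrite /between !iota_mono.
Qed.

Lemma kcompl_img P V : partition P V -> kcompl (img P) = img (kcompl P).
Proof.
move=> pP; have pI := partition_img pP; have pK := kcompl_partition pP.
apply: (eq_partition (kcompl_partition pI) (partition_img pK)) => x y.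
apply/idP/idP; rewrite (same_block_kcompl _ _ pI).
  case/and3P=> /imsetP[a aV ->] /imsetP[b bV ->]; rewrite krel_img => ab.
  by rewrite same_block_img (same_block_kcompl _ _ pP) aV bV.
case/same_block_imgP=> a [b [-> ->]]; rewrite (same_block_kcompl _ _ pP).
by case/and3P=> aV bV ab; rewrite !imset_f // krel_img.
Qed.

Lemma img_inj : injective (fun P => img P).
Proof. exact/imset_inj/imset_inj. Qed.

Lemma ncpart_img : ncpart (iota @: setT) = [set img P | P in ncpart setT].
Proof.
apply/setP => Q; apply/idP/imsetP => [ncQ|[P ncP ->]]; last first.
  have pP := ncpart_partition ncP; have pI := partition_img pP.
  rewrite inE pI; apply/(noncrossingP _ pI) => w x y z wx xy yz.
  case/same_block_imgP=> a [c [ea ec ac]] /same_block_imgP[b [d [eb ed bd]]].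
  move: wx xy yz; rewrite ea eb ec ed !iota_mono same_block_img => ab bc cd.
  exact: (ncpart_cross ncP ab bc cd ac bd).
have pQ := ncpart_partition ncQ.
have subQ (B : {set 'I_n}) : B \in Q -> B \subset iota @: setT.
  by move=> BQ; rewrite -(cover_partition pQ); apply: bigcup_sup BQ.
have preK (B : {set 'I_n}) : B \in Q -> iota @: (iota @^-1: B) = B.
  move=> /subQ/subsetP sB; apply/setP => x; apply/imsetP/idP => [[a]|xB].
    by rewrite inE => aB ->.
  by have /imsetP[a _ ea] := sB x xB; exists a; rewrite // inE -ea.
pose P := [set iota @^-1: B | B : {set 'I_n} in Q].
have imP : img P = Q.
  apply/setP => B; apply/imsetP/idP => [[_ /imsetP[C CQ ->] ->]|BQ].
    by rewrite preK.
  by exists (iota @^-1: B); rewrite ?preK ?imset_f.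
have sbP a b : same_block P a b = same_block Q (iota a) (iota b).
  by rewrite -imP same_block_img.
exists P => //; have pP : partition P setT.
  apply/and3P; split.
  - apply/eqP/setP => a; rewrite inE; apply/bigcupP.
    have : iota a \in cover Q by rewrite (cover_partition pQ) imset_f.
    case/bigcupP=> B BQ aB; exists (iota @^-1: B); last by rewrite inE.
    exact: imset_f.
  - apply/trivIsetP => _ _ /imsetP[B BQ ->] /imsetP[C CQ ->] neqBC.
    have dBC : [disjoint B & C].
      case/and3P: pQ => _ /trivIsetP tQ _; apply: tQ => //.
      by apply: contraNneq neqBC => ->.
    apply/pred0P => a /=; rewrite !inE; exact: (pred0P dBC).
  - apply/imsetP => -[B BQ e0]; have := preK _ BQ; rewrite -e0 imset0 => eB.
    by case/and3P: pQ => _ _; rewrite eB BQ.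
rewrite inE pP; apply/(noncrossingP _ pP) => a b c d ab bc cd; rewrite !sbP.
by apply: (ncpart_cross ncQ); rewrite iota_mono.
Qed.

End Transport.

Definition wordon (n : nat) (T : Type) (W : 'I_n -> T) (V : {set 'I_n}) : seq T :=
  [seq W i | i <- enum V].

Definition wcoef (n : nat) (T : Type) (R : comNzRingType) (X : seq T -> R)
    (W : 'I_n -> T) (P : {set {set 'I_n}}) : R :=
  \prod_(B in P) X (wordon W B).

Lemma enum_ord_sorted (n : nat) (V : {set 'I_n}) :
  sorted (fun i j : 'I_n => i < j)%N (enum V).
Proof.
rewrite /enum_mem; apply: sorted_filter; first by move=> j i k; apply: ltn_trans.
by rewrite -[sorted _ _](@sorted_map _ _ (@nat_of_ord n) ltn) -enumT val_enum_ord iota_ltn_sorted.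
Qed.

Lemma enum_imset_mono (r n : nat) (iota : 'I_r -> 'I_n) (B : {set 'I_r}) :
  {mono iota : i j / (i < j)%N} -> enum (iota @: B) = map iota (enum B).
Proof.
move=> iota_mono; apply: (@irr_sorted_eq _ (fun i j : 'I_n => i < j)%N).
- by move=> j i k; apply: ltn_trans.
- by move=> i; apply: ltnn.
- exact: enum_ord_sorted.
- by rewrite (mono_sorted (e := fun i j : 'I_r => (i < j)%N)) // enum_ord_sorted.
move=> x; rewrite mem_enum; apply/imsetP/mapP => -[a aB ->]; exists a => //.
  by rewrite mem_enum.
by rewrite -mem_enum.
Qed.

Lemma wordon_imset (r n : nat) (T : Type) (iota : 'I_r -> 'I_n) (W : 'I_n -> T)
    (U : 'I_r -> T) (B : {set 'I_r}) :
  {mono iota : i j / (i < j)%N} -> (forall i, U i = W (iota i)) ->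
  wordon U B = wordon W (iota @: B).
Proof.
move=> iota_mono eU; rewrite /wordon enum_imset_mono // -map_comp.
exact: eq_map.
Qed.

(** The definition numbers the positions of each subword afresh. Transport along the increasing
    enumeration of [V] brings all subwords of [W] back to the single set ['I_n], where their
    partitions can be compared. *)
Lemma boxed_coef_wordon (s n : nat) (R : comNzRingType) (X Y : seq 'I_s -> R)
    (W : 'I_n -> 'I_s) (V : {set 'I_n}) :
  boxed_coef X Y (wordon W V) =
  \sum_(P in ncpart V) wcoef X W P * wcoef Y W (kcompl P).
Proof.
set u := wordon W V.
have szu : size u = #|V| by rewrite size_map -cardE.
pose iota (i : 'I_(size u)) := enum_val (cast_ord szu i).
have iotaE x0 i : iota i = nth x0 (enum V) i by rewrite /iota (enum_val_nth x0).
have lt_iota (i j : 'I_(size u)) : (i < j)%N -> (iota i < iota j)%N.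
  have x0 := iota i; move=> ij; rewrite !(iotaE x0).
  apply: (sorted_ltn_nth _ _ (enum_ord_sorted V)); rewrite ?inE -?cardE -?szu //.
  by move=> b a c; apply: ltn_trans.
have iota_mono : {mono iota : i j / (i < j)%N}.
  move=> i j; case: (ltngtP i j) => [/lt_iota //|/lt_iota ji|/val_inj ->].
    by rewrite ltnNge ltnW.
  by rewrite ltnn.
have imV : iota @: setT = V.
  apply/setP => x; apply/imsetP/idP => [[i _ ->]|xV]; first exact: enum_valP.
  exists (cast_ord (esym szu) (enum_rank_in xV x)) => //.
  by rewrite /iota cast_ordKV enum_rankK_in.
have eU i : tnth (in_tuple u) i = W (iota i).
  rewrite (tnth_nth (W (iota i))) /= (nth_map (iota i)) -?cardE -?szu //.
  by rewrite -iotaE.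
have wimg (Z : seq 'I_s -> R) (P : {set {set 'I_(size u)}}) :
    coef_part Z P = wcoef Z W [set iota @: B | B : {set 'I_(size u)} in P].
  rewrite /coef_part /wcoef big_imset /=; last first.
    move=> B C _ _; apply: imset_inj => i j eij; apply: val_inj.
    by have := iota_mono i j; have := iota_mono j i; rewrite eij ltnn; case: ltngtP.
  by apply: eq_bigr => B _; rewrite -(wordon_imset _ iota_mono eU).
rewrite /boxed_coef -{1}imV (ncpart_img iota_mono) big_imset /=; last first.
  by move=> P Q _ _; apply: img_inj iota_mono _ _.
apply: eq_bigr => P ncP; rewrite krewerasE // !wimg.
by rewrite (kcompl_img iota_mono (ncpart_partition ncP)).
Qed.

(** * Blockwise expansion of the boxed convolution *)

Section Blockwise.
Variable n : nat.
Implicit Types (P Q rho chi : {set {set 'I_n}}) (V B C : {set 'I_n}).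

Definition subblocks chi B := [set C in chi | C \subset B].

Section Refinement.
Variables (chi rho : {set {set 'I_n}}) (V : {set 'I_n}).
Hypotheses (pc : partition chi V) (pr : partition rho V) (cr : refines chi rho).

Lemma block_unique B B' C : B \in rho -> B' \in rho -> C \in chi ->
  C \subset B -> C \subset B' -> B = B'.
Proof.
move=> Br Br' Cc /subsetP CB /subsetP CB'; case/and3P: pr => _ tr _.
have /set0Pn[x xC] : C != set0 by apply: contraTneq Cc => ->; case/and3P: pc.
by rewrite -(def_pblock tr Br (CB _ xC)) (def_pblock tr Br' (CB' _ xC)).
Qed.

Lemma same_block_subblocks B x y : B \in rho ->
  same_block (subblocks chi B) x y = (x \in B) && same_block chi x y.
Proof.
move=> Br; apply/same_blockP/andP => [[C [/setIdP[Cc /subsetP CB] xC yC]]|].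
  by split; [apply: CB | apply/same_blockP; exists C].
case=> xB /same_blockP[C [Cc xC yC]]; exists C; split=> //; apply/setIdP; split=> //.
have /exists_inP[B' Br' CB'] := forall_inP cr C Cc.
suff <- : B' = B by [].
case/and3P: pr => _ tr _.
by rewrite -(def_pblock tr Br xB) (def_pblock tr Br' (subsetP CB' _ xC)).
Qed.

Lemma partition_subblocks B : B \in rho -> partition (subblocks chi B) B.
Proof.
move=> Br; apply/and3P; split.
- apply/eqP/setP => x; apply/bigcupP/idP => [[C /setIdP[_ /subsetP CB] /CB //]|xB].
  have xV : x \in V by rewrite -(cover_partition pr); apply/bigcupP; exists B.
  have := same_block_subblocks x x Br; rewrite xB (same_block_refl x pc) xV.
  by case/same_blockP=> C [Cc xC _]; exists C.
- case/and3P: pc => _ /trivIsetP tc _; apply/trivIsetP => C C' /setIdP[Cc _].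
  by case/setIdP=> Cc' _; apply: tc.
- by rewrite inE negb_and; case/and3P: pc => _ _ ->.
Qed.

Lemma bigcup_subblocks : \bigcup_(B in rho) subblocks chi B = chi.
Proof.
apply/setP => C; apply/bigcupP/idP => [[B _ /setIdP[]] //|Cc].
have /exists_inP[B Br CB] := forall_inP cr C Cc.
by exists B => //; apply/setIdP.
Qed.

Lemma prod_subblocks (R : comNzRingType) (G : {set 'I_n} -> R) :
  \prod_(C in chi) G C = \prod_(B in rho) \prod_(C in subblocks chi B) G C.
Proof.
(* The block of [rho] containing [C]; for [C] in [chi] it exists by refinement, so the default is
   not reached. *)
pose p C := odflt set0 [pick B in rho | C \subset B].
have pP C : C \in chi -> (p C \in rho) && (C \subset p C).
  move=> /(forall_inP cr)/exists_inP[B Br CB]; rewrite /p.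
  by case: pickP => [//|/(_ B)]; rewrite /= Br CB.
rewrite (partition_big p (mem rho)) => [|C /pP/andP[]//].
apply: eq_bigr => B Br; apply: eq_bigl => C; rewrite inE; apply: andb_id2l => Cc.
have /andP[pr' Cp] := pP C Cc; apply/eqP/idP => [<- //|CB].
exact: block_unique pr' Br Cc Cp CB.
Qed.

End Refinement.

Lemma subblocks_nc V B chi rho : chi \in ncpart V -> partition rho V ->
  refines chi rho -> B \in rho -> subblocks chi B \in ncpart B.
Proof.
move=> ncc pr cr Br; have pc := ncpart_partition ncc.
have ps := partition_subblocks pc pr cr Br.
rewrite inE ps; apply/(noncrossingP _ ps) => a b c d ab bc cd.
rewrite !(same_block_subblocks pr cr _ _ Br) => /andP[-> ac] /andP[_ bd].
exact: (ncpart_cross ncc ab bc cd ac bd).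
Qed.

(** Complements can be taken block by block. Saturation for the part of [chi] inside [B] extends to
    all of [chi], because [rho] is noncrossing. *)
Lemma kcompl_subblocks V B chi rho : chi \in ncpart V -> rho \in ncpart V ->
  refines chi rho -> B \in rho ->
  kcompl (subblocks chi B) = subblocks (relcompl chi rho) B.
Proof.
move=> ncc ncr cr Br; have pc := ncpart_partition ncc.
have pr := ncpart_partition ncr; have prc := relcompl_partition chi pr.
have rr : refines (relcompl chi rho) rho by apply: relcompl_refines pr.
have ps := partition_subblocks pc pr cr Br.
apply: (eq_partition (kcompl_partition ps) (partition_subblocks prc pr rr Br)) => x y.
rewrite (same_block_kcompl _ _ ps) (same_block_subblocks pr rr _ _ Br).
rewrite (same_block_relcompl _ _ _ pr); apply: andb_id2l => xB.
rewrite (same_block_mem y pr Br xB) andbC; apply: andb_id2r => yB.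
apply/idP/idP => [|/krelP h]; last first.
  apply/krelP => a b; rewrite (same_block_subblocks pr cr _ _ Br).
  by case/andP=> _; apply: h.
wlog xy : x y xB yB / (x < y)%N => [hw|].
  have [h|h|/val_inj ->] := ltngtP x y; [exact: hw| |by rewrite !krel_refl].
  by rewrite krel_sym [krel chi _ _]krel_sym; apply: hw.
move=> /(krelPle _ (ltnW xy)) h; apply/(krelPle _ (ltnW xy))/saturated_imply.
move=> /= a b ab xay.
have [aB|naB] := boolP (a \in B).
  by rewrite -(h a b) // (same_block_subblocks pr cr _ _ Br) aB.
(* For [a] outside [B], its [rho]-mate [b] cannot leave the interval without crossing the pair [x],
   [y] of [B]. *)
have rab := refinesP pc pr cr _ _ ab.
have nbB : b \notin B.
  apply: contra naB => bB; rewrite -(same_block_mem a pr Br bB).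
  by rewrite same_block_sym.
have rxy : same_block rho x y by rewrite (same_block_mem y pr Br xB).
have ax : (a == x) = false by apply: contraNF naB => /eqP->.
have ay : (a == y) = false by apply: contraNF naB => /eqP->.
have bx : (b == x) = false by apply: contraNF nbB => /eqP->.
case/andP: xay => xa; rewrite leq_eqVlt (inj_eq val_inj) ay /= => {}ay.
rewrite ltnNge leq_eqVlt (inj_eq val_inj) bx /= -leqNgt.
apply/andP; split; rewrite leqNgt; apply/negP.
  move=> {}bx.
  case/negP: nbB; rewrite -(same_block_mem b pr Br xB) same_block_sym.
  by apply: (ncpart_cross ncr bx xa ay _ rxy); rewrite same_block_sym.
move=> yb; case/negP: naB; rewrite -(same_block_mem a pr Br xB).
exact: (ncpart_cross ncr xa ay yb rxy rab).
Qed.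

Section Union.
Variables (rho : {set {set 'I_n}}) (V : {set 'I_n}).
Variable f : {set 'I_n} -> {set {set 'I_n}}.
Hypotheses (ncr : rho \in ncpart V) (ncf : forall B, B \in rho -> f B \in ncpart B).

Let pr := ncpart_partition ncr.

Let block_sub B C : B \in rho -> C \in f B -> C \subset B.
Proof.
by move=> Br Cf; rewrite -(cover_partition (ncpart_partition (ncf Br))); apply: bigcup_sup Cf.
Qed.

Let block_n0 B C : B \in rho -> C \in f B -> C != set0.
Proof.
move=> Br Cf; apply: contraTneq Cf => ->.
by case/and3P: (ncpart_partition (ncf Br)).
Qed.

Let U := \bigcup_(B in rho) f B.

Lemma subblocks_bigcup B : B \in rho -> subblocks U B = f B.
Proof.
move=> Br; apply/setP => C; apply/setIdP/idP => [[/bigcupP[B' Br' Cf] CB]|Cf].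
  have /set0Pn[x xC] := block_n0 Br' Cf; case/and3P: pr => _ tr _.
  rewrite -(def_pblock tr Br (subsetP CB _ xC)).
  by rewrite (def_pblock tr Br' (subsetP (block_sub Br' Cf) _ xC)).
by split; [apply/bigcupP; exists B | apply: block_sub].
Qed.

Lemma refines_bigcup : refines U rho.
Proof.
apply/forall_inP => C /bigcupP[B Br Cf]; apply/exists_inP; exists B => //.
exact: block_sub Cf.
Qed.

(** Crossing pairs would lie in blocks of [rho] that cross, hence in one block [B], where [f B] is
    noncrossing. *)
Lemma bigcup_ncpart : U \in ncpart V.
Proof.
have pU : partition U V.
  apply/and3P; split.
  - apply/eqP/setP => x; rewrite -(cover_partition pr).
    apply/bigcupP/bigcupP => [[C /bigcupP[B Br Cf] xC]|[B Br xB]].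
      by exists B => //; apply: (subsetP (block_sub Br Cf)).
    have : x \in cover (f B) by rewrite (cover_partition (ncpart_partition (ncf Br))).
    by case/bigcupP=> C Cf xC; exists C => //; apply/bigcupP; exists B.
  - apply/trivIsetP => C C' /bigcupP[B Br Cf] /bigcupP[B' Br' Cf'] neqC.
    have [eB|neqB] := eqVneq B B'.
      case/and3P: (ncpart_partition (ncf Br)) => _ /trivIsetP tf _; apply: tf => //.
      by rewrite eB.
    case/and3P: pr => _ /trivIsetP tr _.
    apply: disjointWl (block_sub Br Cf) _; apply: disjointWr (block_sub Br' Cf') _.
    exact: tr.
  - by apply/bigcupP => -[B Br f0]; have /eqP := block_n0 Br f0.
rewrite inE pU; apply/(noncrossingP _ pU) => a b c d ab bc cd.
have sbU x y : same_block U x y -> exists2 B, B \in rho & same_block (f B) x y.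
  case/same_blockP=> C [/bigcupP[B Br Cf] xC yC]; exists B => //.
  by apply/same_blockP; exists C.
case/sbU=> B Br ac /sbU[B' Br' bd]; case/and3P: (pr) => _ tr _.
have pB := ncpart_partition (ncf Br); have pB' := ncpart_partition (ncf Br').
have aB := same_block_inl pB ac; have cB := same_block_inr pB ac.
have bB := same_block_inl pB' bd; have dB := same_block_inr pB' bd.
have := ncpart_cross ncr ab bc cd.
rewrite (same_block_mem c pr Br aB) (same_block_mem d pr Br' bB) => /(_ cB dB).
rewrite (same_block_mem b pr Br aB) => bB2.
have eB : B' = B by rewrite -(def_pblock tr Br bB2) (def_pblock tr Br' bB).
rewrite eB in bd; have /same_blockP[C [Cf aC bC]] := ncpart_cross (ncf Br) ab bc cd ac bd.
by apply/same_blockP; exists C; split=> //; apply/bigcupP; exists B.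
Qed.

End Union.

Lemma prod_sum_blocks (R : comNzRingType) (F : {set 'I_n} -> {set {set 'I_n}} -> R)
    rho V : rho \in ncpart V ->
  \prod_(B in rho) \sum_(P in ncpart B) F B P =
  \sum_(chi in ncpart V | refines chi rho) \prod_(B in rho) F B (subblocks chi B).
Proof.
move=> ncr; have pr := ncpart_partition ncr.
rewrite (big_distr_big_dep set0).
(* Choices of a noncrossing partition in every block of [rho] correspond to noncrossing [chi] finer
   than [rho], by restriction and union. The value [set0] off [rho] matches the default of the
   distributed product. *)
pose h chi := [ffun B => if B \in rho then subblocks chi B else set0].
pose h' (f : {ffun {set 'I_n} -> {set {set 'I_n}}}) := \bigcup_(B in rho) f B.
rewrite (reindex_onto h h') => [|f /pfamilyP[/supportP f0 ncf]]; last first.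
  apply/ffunP => B; rewrite ffunE; case: ifPn => [Br|/f0 //].
  by apply: subblocks_bigcup ncr _ _ Br => C Cr; apply: ncf.
have hE chi B : B \in rho -> h chi B = subblocks chi B by rewrite ffunE => ->.
apply: eq_big => [chi|chi _]; last by apply: eq_bigr => B Br; rewrite hE.
have h'h : h' (h chi) = \bigcup_(B in rho) subblocks chi B.
  by apply: eq_bigr => B Br; rewrite hE.
apply/andP/andP => [[/pfamilyP[_ nch] /eqP <-]|[ncc cr]].
  have ncf B : B \in rho -> h chi B \in ncpart B by move=> Br; apply: nch.
  by split; [apply: bigcup_ncpart | apply: refines_bigcup ncf].
split; last by rewrite h'h (bigcup_subblocks cr).
apply/pfamilyP; split=> [|B Br]; last by rewrite hE //; apply: subblocks_nc pr cr Br.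
by apply/supportP => B nBr; rewrite ffunE (negPf nBr).
Qed.

(** Expanding one boxed coefficient per block of [rho] and distributing reassembles the choices into
    [chi], and the blockwise complements into [relcompl chi rho]. *)
Lemma wcoef_boxed (s : nat) (R : comNzRingType) (X Y Z : seq 'I_s -> R)
    (W : 'I_n -> 'I_s) rho V : rho \in ncpart V ->
  (forall B, B \in rho -> Z (wordon W B) = boxed_coef X Y (wordon W B)) ->
  wcoef Z W rho = \sum_(chi in ncpart V | refines chi rho)
                     wcoef X W chi * wcoef Y W (relcompl chi rho).
Proof.
move=> ncr eZ; have pr := ncpart_partition ncr; rewrite {1}/wcoef.
rewrite (eq_bigr _ (fun B Br => etrans (eZ B Br) (boxed_coef_wordon X Y W B))).
rewrite (prod_sum_blocks _ ncr); apply: eq_bigr => chi /andP[ncc cr].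
have pc := ncpart_partition ncc; rewrite big_split /=; congr (_ * _).
  by rewrite /wcoef (prod_subblocks pc pr cr).
rewrite {2}/wcoef (prod_subblocks (relcompl_partition chi pr) pr); last first.
  exact: relcompl_refines pr.
by apply: eq_bigr => B Br; rewrite (kcompl_subblocks ncc ncr cr Br).
Qed.

(* Interval by interval, the boxed convolution is the product of the incidence
   algebra of the noncrossing partitions of V. *)
Lemma wcoef_relcompl_boxed (s : nat) (R : comNzRingType) (X Y Z : seq 'I_s -> R)
    (W : 'I_n -> 'I_s) V sg pi :
  sg \in ncpart V -> pi \in ncpart V -> refines sg pi ->
  (forall B, B \subset V -> B != set0 -> Z (wordon W B) = boxed_coef X Y (wordon W B)) ->
  wcoef Z W (relcompl sg pi) =
  \sum_(tau in ncpart V | refines sg tau && refines tau pi)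
     wcoef X W (relcompl sg tau) * wcoef Y W (relcompl tau pi).
Proof.
move=> ncs ncp sp eZ; have ncr := relcompl_nc sg ncp; have pr := ncpart_partition ncr.
rewrite (wcoef_boxed (X := X) (Y := Y) ncr) => [|B Br]; last first.
  apply: eZ; first by rewrite -(cover_partition pr); apply: bigcup_sup Br.
  by apply: contraTneq Br => ->; case/and3P: pr.
transitivity (\sum_(chi in [set chi in ncpart V | refines chi (relcompl sg pi)])
                 wcoef X W chi * wcoef Y W (relcompl chi (relcompl sg pi))).
  by apply: eq_bigl => chi; rewrite inE.
rewrite -(relcompl_interval ncs ncp sp) big_imset /=; last first.
  move=> t1 t2 /setIdP[nc1 /andP[s1 _]] /setIdP[nc2 /andP[s2 _]].
  by apply: (relcompl_inj ncs); apply/setIdP.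
apply: eq_big => [tau|tau /setIdP[nct /andP[st tp]]]; first by rewrite inE.
by rewrite (relcompl_relcompl ncs nct ncp st).
Qed.

End Blockwise.

(** * The representations *)

Section Representation.
Variables s n : nat.
Notation index_type := ({ffun 'I_n -> 'I_s} * {set {set 'I_n}})%type.
Implicit Types (x y z : index_type).

Definition ncindex : {set index_type} := [set x | x.2 \in ncpart (cover x.2)].

(** The number of pairs joined by a partition grows strictly under proper coarsening, so sorting by
    it yields a linear extension. *)
Definition block_pairs x := [set p : 'I_n * 'I_n | same_block x.2 p.1 p.2].

(* Listed along a linear extension of refinement, so that the matrices of the
   representation are upper triangular. *)
Definition ncseq : seq index_type :=
  sort (fun x y => #|block_pairs x| <= #|block_pairs y|)%N (enum ncindex).

Definition ncix (i : 'I_(size ncseq)) : index_type := tnth (in_tuple ncseq) i.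

Implicit Types i j : 'I_(size ncseq).

Lemma ncix_in i : ncix i \in ncindex.
Proof. by have := mem_tnth i (in_tuple ncseq); rewrite mem_sort mem_enum. Qed.

Lemma ncix_inj : injective ncix.
Proof. by apply/tuple_uniqP; rewrite /= sort_uniq enum_uniq. Qed.

Lemma ncix_onto x : x \in ncindex -> exists i, ncix i = x.
Proof.
move=> xI; have : x \in in_tuple ncseq by rewrite mem_sort mem_enum.
by case/tnthP=> i ->; exists i.
Qed.

Lemma ncix_sorted i j : (i < j)%N ->
  (#|block_pairs (ncix i)| <= #|block_pairs (ncix j)|)%N.
Proof.
move=> ij; rewrite /ncix !(tnth_nth (ncix i)).
apply: (@sorted_ltn_nth _ (fun x y => #|block_pairs x| <= #|block_pairs y|)%N).
- by move=> y x z; apply: leq_trans.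
- by apply: sort_sorted => x y; apply: leq_total.
- by rewrite inE.
- by rewrite inE.
- exact: ij.
Qed.

Lemma ncindex_partition x : x \in ncindex -> partition x.2 (cover x.2).
Proof. by rewrite inE => /ncpart_partition. Qed.

(** Indices with different words or different sets of positions are incomparable: the poset is a
    disjoint union, and the representation a direct sum. *)
Definition below x y := [&& x.1 == y.1, cover x.2 == cover y.2 & refines x.2 y.2].

Lemma below_refl x : below x x.
Proof. by rewrite /below !eqxx refines_refl. Qed.

Lemma below_trans x y z : x \in ncindex -> y \in ncindex -> z \in ncindex ->
  below x y -> below y z -> below x z.
Proof.
move=> /ncindex_partition px /ncindex_partition py /ncindex_partition pz.
rewrite /below => /and3P[/eqP-> /eqP cxy xy] /and3P[/eqP-> /eqP cyz yz].
rewrite cxy cyz in px; rewrite cyz in py.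
by rewrite eqxx cxy cyz eqxx (refines_trans px py pz xy yz).
Qed.

Lemma below_block_pairs x y : x \in ncindex -> y \in ncindex -> below x y ->
  (#|block_pairs y| <= #|block_pairs x|)%N -> x = y.
Proof.
case: x y => W P [W' Q] /ncindex_partition/= pP /ncindex_partition/= pQ.
case/and3P=> /= /eqP<- /eqP cPQ PQ; rewrite -cPQ in pQ.
have sub := refinesP pP pQ PQ => card_le.
have /eqP eqPQ : block_pairs (W, P) == block_pairs (W, Q).
  rewrite eqEcard card_le andbT; apply/subsetP => -[a b].
  by rewrite !inE /=; apply: sub.
congr (_, _); apply: (eq_partition pP pQ) => a b.
by have /setP/(_ (a, b)) := eqPQ; rewrite !inE.
Qed.

Section Entries.
Variable R : comNzRingType.
Implicit Types X Y Z : seq 'I_s -> R.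

Definition entry X x y := if below x y then wcoef X x.1 (relcompl x.2 y.2) else 0.

(** Terms with [z] outside the interval from [x] to [y] vanish, and what remains is
    [wcoef_relcompl_boxed]. Only words of length at most [n] are constrained, as befits truncated
    series. *)
Lemma entry_mul X Y Z x y :
  (forall w, w != [::] -> (size w <= n)%N -> Z w = boxed_coef X Y w) ->
  x \in ncindex -> y \in ncindex ->
  entry Z x y = \sum_(z in ncindex) entry X x z * entry Y z y.
Proof.
move=> eZ xI yI; rewrite {1}/entry; case: ifPn => [xy|nxy]; last first.
  rewrite big1 // => z zI; rewrite /entry; case: ifP => xz; last by rewrite mul0r.
  case: ifP => zy; last by rewrite mulr0.
  by case/negP: nxy; apply: below_trans xz zy.
rewrite (bigID (fun z => below x z && below z y)) /= [X in _ + X]big1 ?addr0; last first.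
  move=> z /andP[zI]; rewrite negb_and /entry => /orP[]/negPf->.
    by rewrite mul0r.
  by rewrite mulr0.
case/and3P: (xy) => /eqP eW /eqP eV xy2; set V := cover x.2 in eV.
have ncx : x.2 \in ncpart V by move: xI; rewrite inE.
have ncy : y.2 \in ncpart V by move: yI; rewrite inE -eV.
rewrite (wcoef_relcompl_boxed (X := X) (Y := Y) ncx ncy xy2); last first.
  move=> B _ B0; apply: eZ.
    by rewrite -size_eq0 size_map -cardE cards_eq0.
  by rewrite size_map -cardE -[leqRHS]card_ord max_card.
rewrite [RHS](reindex_onto (fun tau => (x.1, tau)) snd) => [|[W P]]; last first.
  by case/andP=> _ /andP[/and3P[/= /eqP->]].
apply: eq_big => [tau|tau /andP[nct /andP[st tp]]].
  rewrite eqxx andbT /below /= eW eqxx /= -eV -/V [_ \in ncindex]inE /=.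
  rewrite [cover tau == V]eq_sym; have [<- //|neV] := eqVneq V (cover tau).
  rewrite !andbF; apply: contraNF neV => /andP[/ncpart_partition/cover_partition->].
  by rewrite eqxx.
have eT : cover tau = V := cover_partition (ncpart_partition nct).
by rewrite /entry /below /= eW eqxx eT -eV -/V eqxx /= st tp.
Qed.

Definition repmx X : 'M[R]_(size ncseq) := \matrix_(i, j) entry X (ncix i) (ncix j).

Lemma repmx_mul X Y Z :
  (forall w, w != [::] -> (size w <= n)%N -> Z w = boxed_coef X Y w) ->
  repmx Z = repmx X *m repmx Y.
Proof.
move=> eZ; apply/matrixP => i j.
rewrite !mxE (entry_mul eZ (ncix_in i) (ncix_in j)).
under [RHS]eq_bigr do rewrite !mxE.
rewrite -(big_tuple _ _ (in_tuple ncseq) predT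
            (fun z => entry X (ncix i) z * entry Y z (ncix j))) /=.
by rewrite [RHS](perm_big (enum ncindex)) ?perm_sort // big_enum.
Qed.

Lemma repmx_trig X : is_trig_mx (repmx X)^T.
Proof.
apply/is_trig_mxP => i j ij; rewrite !mxE /entry; case: ifP => // le_ji.
have /ncix_inj eji := below_block_pairs (ncix_in j) (ncix_in i) le_ji (ncix_sorted ij).
by rewrite eji ltnn in ij.
Qed.

Lemma wordon1 (W : 'I_n -> 'I_s) (a : 'I_n) : wordon W [set a] = [:: W a].
Proof. by rewrite /wordon enum_set1. Qed.

Lemma repmx_diag X i :
  repmx X i i = \prod_(a in cover (ncix i).2) X [:: (ncix i).1 a].
Proof.
rewrite mxE /entry below_refl; have := ncix_in i; rewrite inE => /relcompl_self ->.
rewrite /wcoef big_imset /=; last by move=> a b _ _; apply: set1_inj.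
by apply: eq_bigr => a _; rewrite wordon1.
Qed.

End Entries.

Lemma map_repmx (R S : comNzRingType) (phi : {rmorphism R -> S}) X Y :
  (forall w, Y w = phi (X w)) -> map_mx phi (repmx X) = repmx Y.
Proof.
move=> eY; apply/matrixP => i j; rewrite !mxE /entry; case: ifP => _; last exact: rmorph0.
by rewrite /wcoef rmorph_prod; apply: eq_bigr => B _; rewrite eY.
Qed.

Lemma enum_initial m : (m <= n)%N ->
  map val (enum [set i : 'I_n | i < m]%N) = iota 0 m.
Proof.
move=> mn; apply: (irr_sorted_eq ltn_trans ltnn).
- by rewrite sorted_map; apply: enum_ord_sorted.
- exact: iota_ltn_sorted.
move=> i; rewrite mem_iota add0n /=; apply/mapP/idP => [[a]|im].
  by rewrite mem_enum inE => am ->.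
by exists (Ordinal (leq_trans im mn)); rewrite ?mem_enum ?inE.
Qed.

(* Placing a word at the first positions, its coefficient is the entry from the
   partition into singletons to the partition with one block. *)
Lemma repmx_coef (w : seq 'I_s) : w != [::] -> (size w <= n)%N ->
  exists p q : 'I_(size ncseq),
    (forall (R : comNzRingType) (X : seq 'I_s -> R), repmx X p q = X w) /\
    (size w = 1 -> p = q).
Proof.
case: w => // a0 w0 _; move: (a0 :: w0) (isT : a0 :: w0 != [::]) => w w0' szw.
(* Beyond [w] the word [W] is padded with the first letter [a0]; these positions lie outside [V]. *)
pose W := [ffun i : 'I_n => nth a0 w i]; pose V := [set i : 'I_n | i < size w]%N.
have wV : wordon W V = w.
  have -> : wordon W V = map (nth a0 w) (map val (enum V)).
    by rewrite /wordon -map_comp; apply: eq_map => i; rewrite ffunE.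
  by rewrite enum_initial // map_nth_iota0 // take_size.
have cV : #|V| = size w by rewrite -wV size_map cardE.
have V0 : V != set0 by rewrite -cards_eq0 cV size_eq0.
have c1 := cover_partition (partition_singletons V).
have c2 := cover_partition (partition_setV V0).
have /ncix_onto[p ep] : (W, [set [set x] | x in V]) \in ncindex.
  by rewrite inE /= c1 ncpart_singletons.
have /ncix_onto[q eq] : (W, [set V]) \in ncindex by rewrite inE /= c2 ncpart_setV.
exists p, q; split=> [R X|sz1].
  rewrite mxE ep eq /entry /below /= eqxx c1 c2 eqxx.
  rewrite (refines_singletons (partition_setV V0)) /=.
  by rewrite relcompl_singletons // /wcoef big_set1 wV.
apply: ncix_inj; rewrite ep eq; congr (_, _).
have /eqP/cards1P[a ->] : #|V| = 1 by rewrite cV.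
by rewrite imset_set1.
Qed.

(** The positions do not depend on the ring, which makes reading natural. Letters are read on the
    diagonal, where the target groups control the entries; hence the series read off lies in the
    group. *)
Lemma repmx_coefs :
  exists p q : {ffun word s n -> 'I_(size ncseq)},
    (forall (R : comNzRingType) (X : seq 'I_s -> R) u,
       repmx X (p u) (q u) = X (letters u)) /\
    (forall u, size (letters u) = 1 -> p u = q u).
Proof.
have ex (u : word s n) : exists pq : 'I_(size ncseq) * 'I_(size ncseq),
    (forall (R : comNzRingType) (X : seq 'I_s -> R),
       repmx X pq.1 pq.2 = X (letters u)) /\
    (size (letters u) = 1 -> pq.1 = pq.2).
  have [p [q [h1 h2]]] := repmx_coef (valP u) (size_bseq (val u)).
  by exists (p, q).
have [pq h] := fin_all_exists ex.
exists [ffun u => (pq u).1], [ffun u => (pq u).2]; split=> [R X u|u].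
  by rewrite !ffunE; have [] := h u.
by rewrite !ffunE; have [_] := h u.
Qed.

Lemma coef_boxconv (R : comNzRingType) (f g : tseries s n R) w :
  w != [::] -> (size w <= n)%N ->
  coef (boxconv f g) w = boxed_coef (coef f) (coef g) w.
Proof.
move=> w0 szw; have -> : w = letters (exist _ (Bseq szw) w0 : word s n) by [].
by rewrite coef_letters ffunE.
Qed.

Lemma repmx_boxconv (R : comNzRingType) (f g : tseries s n R) :
  repmx (coef (boxconv f g)) = repmx (coef f) *m repmx (coef g).
Proof. by apply: repmx_mul => w; apply: coef_boxconv. Qed.

Lemma map_repmx_coef (R S : comNzRingType) (phi : {rmorphism R -> S})
    (f : tseries s n R) :
  repmx (coef (map_tseries phi f)) = map_mx phi (repmx (coef f)).
Proof. by apply/esym/map_repmx => w; apply: coef_map_tseries. Qed.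

Lemma repmx_borel (R : comUnitRingType) (f : tseries s n R) :
  gser_pred f -> borel_pred (repmx (coef f)).
Proof.
move=> /forallP uf; rewrite /borel_pred repmx_trig /= -unitmx_tr unitmxE.
rewrite (det_trig (repmx_trig _)); apply: rpred_prod => i _; rewrite mxE repmx_diag.
by apply: rpred_prod => a _; apply: uf.
Qed.

Lemma repmx_unip (R : comUnitRingType) (f : tseries s n R) :
  gser1_pred f -> unip_pred (repmx (coef f)).
Proof.
move=> /forallP uf; rewrite /unip_pred repmx_trig; apply/forallP => i.
by rewrite repmx_diag big1 // => a _; apply/eqP/uf.
Qed.

End Representation.

(** [I] is the common kernel of all base changes that equate [A] and [B], and the unit ideal if
    there are none. It contains the differences of entries, so killing [I] equates the matrices. *)
Lemma mx_eq_locus (k : fieldType) (R : comUnitAlgType k) (N : nat) (A B : 'M[R]_N) :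
  exists I : R -> Prop, is_ideal I /\
    forall (S : comUnitAlgType k) (phi : {lrmorphism R -> S}),
      map_mx phi A = map_mx phi B <-> (forall a, I a -> phi a = 0).
Proof.
exists (fun a => forall (S : comUnitAlgType k) (phi : {lrmorphism R -> S}),
  map_mx phi A = map_mx phi B -> phi a = 0); split.
  split=> [S phi _|a b Ia Ib S phi e|a b Ib S phi e]; first exact: rmorph0.
    by rewrite rmorphD /= (Ia _ _ e) (Ib _ _ e) addr0.
  by rewrite rmorphM /= (Ib _ _ e) mulr0.
move=> S phi; split=> [e a|kerI]; first exact.
apply/matrixP => i j; rewrite !mxE; apply/eqP; rewrite -subr_eq0 -rmorphB.
apply/eqP/kerI => S' psi /matrixP/(_ i j); rewrite !mxE rmorphB /= => ->.
exact: subrr.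
Qed.

(* A natural retraction r of rho exhibits the image of rho as the locus where
   rho (r y) = y. *)
Lemma retract_closed_immersion (k : fieldType) (G H : group_functor k)
    (rho : group_hom G H) (r : forall R : comUnitAlgType k, H R -> G R) :
  (forall (R S : comUnitAlgType k) (phi : {lrmorphism R -> S}) y,
     r S (base_change phi y) = base_change phi (r R y)) ->
  (forall R x, r R (rho R x) = x) ->
  (forall (R : comUnitAlgType k) (y y' : H R), exists I : R -> Prop, is_ideal I /\
     forall (S : comUnitAlgType k) (phi : {lrmorphism R -> S}),
       base_change phi y = base_change phi y' <-> (forall a, I a -> phi a = 0)) ->
  closed_immersion rho.
Proof.
move=> r_nat rK locus; split=> [R|R y]; first exact: can_inj (rK R).
have [I [idI hI]] := locus R (rho R (r R y)) y; exists I; split=> // S phi.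
rewrite -hI -hom_natural -r_nat; split=> [[x <-]|e]; first by rewrite rK.
by exists (r S (base_change phi y)).
Qed.

Lemma tseries_ext (s n : nat) (R : comNzRingType) (f g : tseries s n R) :
  (forall w : word s n, coef f (letters w) = coef g (letters w)) -> f = g.
Proof. by move=> e; apply/ffunP => w; have := e w; rewrite !coef_letters. Qed.

(** * The triangular representations and their retractions *)

Section Main.
Variables (k : fieldType) (s n : nat).
Notation N := (size (ncseq s n)).

Definition borel_rep : group_hom (gser k s n) (borel k N).
Proof.
refine (@GroupHom k (gser k s n) (borel k N)
  (fun R f => exist _ (repmx n (coef (sval f))) (repmx_borel (svalP f))) _ _).
- by move=> R S phi f; apply: val_inj; apply: map_repmx_coef.
- by move=> R f g; apply: val_inj; apply: repmx_boxconv.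
Defined.

Definition unipotent_rep : group_hom (gser1 k s n) (unipotent k N).
Proof.
refine (@GroupHom k (gser1 k s n) (unipotent k N)
  (fun R f => exist _ (repmx n (coef (sval f))) (repmx_unip (svalP f))) _ _).
- by move=> R S phi f; apply: val_inj; apply: map_repmx_coef.
- by move=> R f g; apply: val_inj; apply: repmx_boxconv.
Defined.

Section Retraction.
Variables p q : {ffun word s n -> 'I_N}.
Hypothesis pqE : forall (R : comNzRingType) (X : seq 'I_s -> R) u,
  repmx n X (p u) (q u) = X (letters u).
Hypothesis pq1 : forall u, size (letters u) = 1 -> p u = q u.
Hypothesis n_gt0 : (0 < n)%N.

Definition read_series (R : comNzRingType) (A : 'M[R]_N) : tseries s n R :=
  [ffun u => A (p u) (q u)].

Lemma read_repmx (R : comNzRingType) (f : tseries s n R) :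
  read_series (repmx n (coef f)) = f.
Proof. by apply/ffunP => u; rewrite ffunE pqE coef_letters. Qed.

Lemma read_map (R S : comNzRingType) (phi : {rmorphism R -> S}) (A : 'M[R]_N) :
  read_series (map_mx phi A) = map_tseries phi (read_series A).
Proof. by apply/ffunP => u; rewrite !ffunE mxE. Qed.

Lemma read_letter (R : comNzRingType) (A : 'M[R]_N) (a : 'I_s) :
  exists i, coef (read_series A) [:: a] = A i i.
Proof.
have sz : (size [:: a] <= n)%N by [].
have -> : [:: a] = letters (exist _ (Bseq sz) isT : word s n) by [].
set u : word s n := exist _ _ _; exists (p u).
by rewrite coef_letters ffunE -(pq1 (u := u)).
Qed.

(** The determinant of a triangular matrix is the product of its diagonal, and each factor of a unit
    is a unit. *)
Lemma read_borel (R : comUnitRingType) (A : 'M[R]_N) :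
  borel_pred A -> gser_pred (read_series A).
Proof.
case/andP=> tA; rewrite -unitmx_tr unitmxE (det_trig tA) => uA; apply/forallP => a.
have [i ->] := read_letter A a; move: uA.
by rewrite (bigD1 i) //= unitrM mxE => /andP[].
Qed.

Lemma read_unip (R : comUnitRingType) (A : 'M[R]_N) :
  unip_pred A -> gser1_pred (read_series A).
Proof.
case/andP=> _ /forallP dA; apply/forallP => a.
by have [i ->] := read_letter A a; apply: dA.
Qed.

Lemma borel_rep_closed : closed_immersion borel_rep.
Proof.
pose r (R : comUnitAlgType k) (A : borel k N R) : gser k s n R :=
  exist _ (read_series (sval A)) (read_borel (svalP A)).
apply: (retract_closed_immersion (r := r)) => [R S phi A|R f|R A B].
- by apply: val_inj; apply: read_map.
- by apply: val_inj; apply: read_repmx.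
have [I [idI hI]] := mx_eq_locus (sval A) (sval B); exists I; split=> // S phi.
by rewrite -hI; split=> [/(congr1 sval) //|e]; apply: val_inj.
Qed.

Lemma unipotent_rep_closed : closed_immersion unipotent_rep.
Proof.
pose r (R : comUnitAlgType k) (A : unipotent k N R) : gser1 k s n R :=
  exist _ (read_series (sval A)) (read_unip (svalP A)).
apply: (retract_closed_immersion (r := r)) => [R S phi A|R f|R A B].
- by apply: val_inj; apply: read_map.
- by apply: val_inj; apply: read_repmx.
have [I [idI hI]] := mx_eq_locus (sval A) (sval B); exists I; split=> // S phi.
by rewrite -hI; split=> [/(congr1 sval) //|e]; apply: val_inj.
Qed.

End Retraction.
End Main.

(** * Truncation at length one and the diagonal torus *)

Section Torus.
Variables (k : fieldType) (s : nat).

Definition letter_mx (R : comNzRingType) (f : tseries s 1 R) : 'M[R]_s :=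
  diag_mx (\row_i coef f [:: i]).

Lemma letter_mx_torus (R : comUnitRingType) (f : tseries s 1 R) :
  gser_pred f -> torus_pred (letter_mx f).
Proof.
move=> /forallP uf; rewrite /torus_pred diag_mx_is_diag unitmxE det_diag.
by apply: rpred_prod => i _; rewrite mxE.
Qed.

Definition torus_rep : group_hom (gser k s 1) (torus k s).
Proof.
refine (@GroupHom k (gser k s 1) (torus k s)
  (fun R f => exist _ (letter_mx (sval f)) (letter_mx_torus (svalP f))) _ _).
- move=> R S phi f; apply: val_inj; rewrite /= /letter_mx map_diag_mx.
  by congr diag_mx; apply/rowP => i; rewrite !mxE coef_map_tseries.
- move=> R f g; apply: val_inj; rewrite /= /letter_mx mulmx_diag.
  by congr diag_mx; apply/rowP => i; rewrite !mxE coef_boxconv_letter.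
Defined.

Lemma word1_letter (u : word s 1) : exists a, letters u = [:: a].
Proof.
by case: u => [[[|a [|b w]] //= sw] //= w0]; exists a.
Qed.

Lemma torus_rep_iso : is_isomorphism torus_rep.
Proof.
move=> R; pose d (A : 'M[R]_s) : tseries s 1 R :=
  (* Words are nonempty, so the default [0] is never taken. *)
  [ffun u => if letters u is a :: _ then A a a else 0].
have dE A a : coef (d A) [:: a] = A a a.
  have sz : (size [:: a] <= 1)%N by [].
  have -> : [:: a] = letters (exist _ (Bseq sz) isT : word s 1) by [].
  by rewrite coef_letters ffunE.
have ud (A : torus k s R) : gser_pred (d (sval A)).
  apply/forallP => a; rewrite dE; case: A => A /= /andP[dA].
  have tA : is_trig_mx A.
    apply/is_trig_mxP => i j ij; apply: (is_diag_mxP dA).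
    by rewrite neq_ltn ij.
  by rewrite unitmxE (det_trig tA) (bigD1 a) //= unitrM => /andP[].
exists (fun A => exist _ (d (sval A)) (ud A)) => [f|A]; apply: val_inj => /=.
  apply: tseries_ext => u; have [a ->] := word1_letter u.
  by rewrite dE !mxE eqxx.
apply/matrixP => i j; rewrite !mxE dE.
case: eqVneq => [->|ij]; first by rewrite mulr1n.
rewrite mulr0n; case: A => A /= /andP[/is_diag_mxP dA _].
by rewrite dA.
Qed.

End Torus.

Theorem theorem6p22 (s n : nat) (hs : (1 <= s)%N) (hn : (1 <= n)%N) :
  exists N : nat, (1 <= N)%N /\
    forall k : fieldType,
      [/\ exists rho : group_hom (gser k s n) (borel k N), closed_immersion rho,
          exists rho : group_hom (gser1 k s n) (unipotent k N),
            closed_immersion rho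
        & exists rho : group_hom (gser k s 1) (torus k s), is_isomorphism rho].
Proof.
have [p [q [pqE pq1]]] := repmx_coefs s n.
(* [N] counts the pairs of a word of length [n] and a noncrossing partition of a set of its
   positions, independently of the field. It is positive because a one-letter word has a row index
   below it. *)
exists (size (ncseq s n)); split.
  have sz : (size [:: Ordinal hs] <= n)%N by [].
  exact: leq_ltn_trans (ltn_ord (p (exist _ (Bseq sz) isT : word s n))).
move=> k; split.
- by exists (borel_rep k s n); apply: borel_rep_closed pqE pq1 hn.
- by exists (unipotent_rep k s n); apply: unipotent_rep_closed pqE pq1 hn.
- by exists (torus_rep k s); apply: torus_rep_iso.
Qed.
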